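(* Let $A\in\mathbb{R}^{n_x\times n_x}$ have spectral radius strictly smaller than $1$, let $B\in\mathbb{R}^{n_x\times n_u}$, and let $Q,R,S$ be the LQR weight matrices, with $\begin{bmatrix} Q & S^\top\\ S& R\end{bmatrix}\succ 0$. Let $K_\star=-(R+B^\top PB)^{-1}(B^\top PA+S)$ be the optimal state feedback gain. Let $\tau\ge 1$, $\rho>0$ be such that for all integers $k\ge 0$ $$\|A^k\|\le \tau e^{-\rho k},\qquad \|(A+BK_\star)^k\|\le \tau e^{-\rho k}.$$ Let $H\ge 1$ be an integer and let $L^{(H)}_\star=\{L^{(H)}_{\star;1},\dots,L^{(H)}_{\star;H}\}$ be the optimal solution (minimizer) of $\min_{L^{(H)}} C(L^{(H)})$, where $C(L^{(H)})$ is the LQR cost of the $H$-order disturbance response controller $u_t=L^{(H)}_1w_{t-1}+\cdots+L^{(H)}_Hw_{t-H}$. Then $$\|K_\star-L^{(H)}_{\star;1}\|\le \frac{2\tau^3\left(\|B\|^2\|K_\star\|\|Q\|+\|B\|\|K_\star\|\|S\|\right)}{\lambda_{\min}(R-SQ^{-1}S^\top)\,(1-e^{-2\rho})^{5/2}}\,e^{-H\rho}.$$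
   Context: Notation: $\|\cdot\|$ is the matrix $\ell_2$ (spectral) norm; $\lambda_{\min}(X)$ is the smallest eigenvalue of a symmetric matrix $X$. System: $x_{t+1}=Ax_t+Bu_t+w_t$, $t\ge 0$, with $x_t\in\mathbb{R}^{n_x}$, $u_t\in\mathbb{R}^{n_u}$, and $w_t\sim\mathcal{N}(0,I)$ independent over $t\ge 0$; $w_s=0$ for $s<0$; $x_0$ is an arbitrary fixed vector. The weights are $Q\in\mathbb{R}^{n_x\times n_x}$, $Q\succ0$, $R\in\mathbb{R}^{n_u\times n_u}$, $R\succ 0$ (both symmetric), $S\in\mathbb{R}^{n_u\times n_x}$, with $\begin{bmatrix} Q & S^\top\\ S& R\end{bmatrix}\succ 0$. LQR cost: $C=\lim_{T\to\infty}\frac1T\,\mathbb{E}\sum_{t=0}^{T-1}\left(x_t^\top Qx_t+u_t^\top Ru_t+2u_t^\top Sx_t\right)$. $P$ is the optimal cost-to-go matrix, i.e. the unique positive semidefinite solution of the algebraic Riccati equation $P=A^\top PA-(A^\top PB+S^\top)(R+B^\top PB)^{-1}(B^\top PA+S)+Q$; the controller $u_t=K_\star x_t$ with $K_\star=-(R+B^\top PB)^{-1}(B^\top PA+S)$ is optimal for the LQR problem. For $L^{(H)}=\{L^{(H)}_1,\dots,L^{(H)}_H\}$ with $L^{(H)}_k\in\mathbb{R}^{n_u\times n_x}$, $C(L^{(H)})$ denotes the LQR cost when $u_t=L^{(H)}_1w_{t-1}+\cdots+L^{(H)}_Hw_{t-H}$ for all $t\ge0$. *)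

(* Defs.v *)
From HB Require Import structures.
From mathcomp Require Import all_boot all_order all_algebra finmap.
From mathcomp Require Import complex.
From mathcomp Require Import all_classical all_reals all_analysis.

Set Implicit Arguments.
Unset Strict Implicit.
Unset Printing Implicit Defensive.

Import Order.TTheory GRing.Theory Num.Theory.
Import numFieldNormedType.Exports.

Local Open Scope classical_set_scope.
Local Open Scope ring_scope.

Section Matrices.
Context {F : realType}.

Definition l2norm n (x : 'cV[F]_n) : F := Num.sqrt (\sum_i x i 0 ^+ 2).

(* Needed because the library norm on matrices is the entrywise maximum. *)
Definition spectral_norm m n (M : 'M[F]_(m, n)) : F :=
  sup [set l2norm (M *m x) | x in [set x : 'cV[F]_n | l2norm x <= 1]].

Definition spectral_radius n (M : 'M[F]_n) : F :=
  sup [set ComplexField.Normc.normc z |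
        z in [set z : F[i] | eigenvalue (map_mx (real_complex F) M) z]].

(* Meaningful for symmetric [M], whose eigenvalues are all real. *)
Definition lambda_min n (M : 'M[F]_n) : F := inf [set a | eigenvalue M a].

Definition posdef n (M : 'M[F]_n) : Prop :=
  M^T = M /\ forall x : 'cV[F]_n, x != 0 -> 0 < (x^T *m M *m x) 0 0.

Definition possemidef n (M : 'M[F]_n) : Prop :=
  M^T = M /\ forall x : 'cV[F]_n, 0 <= (x^T *m M *m x) 0 0.

End Matrices.

Section Noise.
Context d (T : measurableType d) {F : realType} (Pr : probability T F).

(* Mutual independence of a family of set systems. *)
Definition mutually_independent (I : choiceType) (G : I -> set (set T)) : Prop :=
  forall (J : {fset I}) (E : I -> set T),
    (forall i, i \in J -> G i (E i)) ->
    Pr (\bigcap_(i in [set` J]) E i) = (\prod_(i <- J) Pr (E i))%E.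

(* The law N(0, I_n) is the n-fold product of N(0, 1), that is, the coordinates
   are mutually independent and N(0, 1) distributed. *)
Definition std_gaussian_vector n (X : 'I_n -> {RV Pr >-> F}) : Prop :=
  (forall (i : 'I_n) (U : set F), measurable U ->
     distribution Pr (X i) U = normal_prob 0 1 U) /\
  mutually_independent (fun i => preimage_set_system setT (X i) measurable).

(* [w t i] is coordinate [i] of the noise vector at time [t];
   [g_sigma_preimage (w t)] is the sigma-algebra of the whole vector. *)
Definition std_gaussian_noise n (w : nat -> 'I_n -> {RV Pr >-> F}) : Prop :=
  (forall t, std_gaussian_vector (w t)) /\
  mutually_independent (fun t => g_sigma_preimage (w t)).

Definition noise_vec n (w : nat -> 'I_n -> {RV Pr >-> F}) (t : nat) (om : T) :
  'cV[F]_n := \col_i w t i om.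

End Noise.

Section LQR.
Context {F : realType} {nx nu : nat}.
Implicit Types (A : 'M[F]_nx) (B : 'M[F]_(nx, nu)).
Implicit Types (Q P : 'M[F]_nx) (R : 'M[F]_nu) (S : 'M[F]_(nu, nx)).

Fixpoint lqr_state A B (x0 : 'cV[F]_nx) (w : nat -> 'cV[F]_nx)
    (u : nat -> 'cV[F]_nu) (t : nat) : 'cV[F]_nx :=
  if t is t'.+1 then A *m lqr_state A B x0 w u t' + B *m u t' + w t' else x0.

Definition stage_cost Q R S (x : 'cV[F]_nx) (u : 'cV[F]_nu) : F :=
  (x^T *m Q *m x + u^T *m R *m u + 2 *: (u^T *m S *m x)) 0 0.

Definition lqr_cost d (T : measurableType d) (Pr : probability T F) Q R S
    (x : nat -> T -> 'cV[F]_nx) (u : nat -> T -> 'cV[F]_nu) : \bar F :=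
  limn (fun N : nat => ((N%:R^-1)%:E *
    'E_Pr[fun om => (\sum_(t < N) stage_cost Q R S (x t om) (u t om))%R])%E).

(* [w_(t-k)], with the convention [w_s = 0] for [s < 0]. *)
Definition past_noise (w : nat -> 'cV[F]_nx) (t k : nat) : 'cV[F]_nx :=
  if (k <= t)%N then w (t - k)%N else 0.

(* [L k] is the coefficient of [w_(t-k-1)]: indices start at 0 here, at 1 in
   the usual notation [L_1, ..., L_H]. *)
Definition drc_input H (L : 'I_H -> 'M[F]_(nu, nx)) (w : nat -> 'cV[F]_nx)
    (t : nat) : 'cV[F]_nu :=
  \sum_(k < H) L k *m past_noise w t k.+1.

Definition drc_cost d (T : measurableType d) (Pr : probability T F) A B Q R S
    (x0 : 'cV[F]_nx) (w : nat -> 'I_nx -> {RV Pr >-> F})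
    H (L : 'I_H -> 'M[F]_(nu, nx)) : \bar F :=
  let W om t := noise_vec w t om in
  let u t om := drc_input L (W om) t in
  let x t om := lqr_state A B x0 (W om) (fun s => u s om) t in
  lqr_cost Pr Q R S x u.

Definition dare_solution A B Q R S P : Prop :=
  P = A^T *m P *m A
      - (A^T *m P *m B + S^T) *m invmx (R + B^T *m P *m B)
          *m (B^T *m P *m A + S)
      + Q.

Definition lqr_gain A B R S P : 'M[F]_(nu, nx) :=
  - (invmx (R + B^T *m P *m B) *m (B^T *m P *m A + S)).

End LQR.

(* Main.v *)
Require Import Defs.
From HB Require Import structures.
From mathcomp Require Import all_boot all_order all_algebra finmap.
From mathcomp Require Import complex.
From mathcomp Require Import all_classical all_reals all_analysis.
From mathcomp Require Import measurable_realfun zify ring lra.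

Set Implicit Arguments.
Unset Strict Implicit.
Unset Printing Implicit Defensive.

Import Order.TTheory GRing.Theory Num.Theory.
Import numFieldNormedType.Exports.

Local Open Scope classical_set_scope.
Local Open Scope ring_scope.

(* Stacking the noise, the cost of [L] is a positive multiple of the quadratic
   form sum_k tr (Phi_k^T Q Phi_k + L_k^T R L_k + 2 L_k^T S Phi_k), where Phi is
   the response of the system to a unit impulse under the inputs L_k.  Both the
   minimizer [Lstar] and the infinite-horizon optimum K (A + B K)^k are
   stationary for this form in the directions supported on k < H: the former by
   optimality, the latter by the Riccati equation, which makes the first variation
   a telescoping sum.  Hence the gap delta between the two on k < H satisfies
   form(delta, delta) = form(tail, delta), where tail is the part of the optimal
   input sequence on k >= H.  Completing the square bounds the left-hand side below
   by lambda_min (R - S Q^-1 S^T) |delta|^2, and exponential decay bounds the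
   right-hand side by a multiple of e^(- H rho) |delta|. *)

(** * Euclidean and spectral norms *)

Section Euclidean.
Context {F : realType}.

(** The cost is a trace form, of Frobenius type, while the claim concerns spectral norms. Testing
    optimality only against rank one directions $u_k v^\top$ contracts the trace form to the same
    form on the vectors $\Phi_k v$, $L_k v$. The whole estimate is then made for one vector $v$ with
    $\|v\|\le 1$, and no dimension factor appears; the direction $u$ is the gap itself applied to
    $v$. Coercivity controls the gap only in the l2 sense over time, and this fixes the powers of
    $1-q$, $q=e^{-2\rho}$. Bounding the state driven by the gap through Cauchy-Schwarz costs
    $(1-q)^{-1/2}$. The state driven by the tail is a convolution of two geometric sequences of
    equal ratio, hence carries a factor $k$, and $\sum_k k q^{k-1}$ costs $(1-q)^{-2}$. One $\tau$
    comes from the closed loop and one from each open-loop response. The $S$ term gives only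
    $\tau^2(1-q)^{-3/2}$ and is enlarged to match. The telescoping sum leaves a boundary term in $P$
    at the horizon; it vanishes in the limit because the closed-loop state decays. *)

Definition dot n (x y : 'cV[F]_n) : F := (x^T *m y) 0 0.

Lemma dotE n (x y : 'cV[F]_n) : dot x y = \sum_i x i 0 * y i 0.
Proof. by rewrite /dot mxE; apply: eq_bigr => i _; rewrite mxE. Qed.

Lemma dotC n (x y : 'cV[F]_n) : dot x y = dot y x.
Proof. by rewrite !dotE; apply: eq_bigr => i _; rewrite mulrC. Qed.

Lemma dot0l n (x : 'cV[F]_n) : dot 0 x = 0.
Proof. by rewrite /dot trmx0 mul0mx mxE. Qed.

Lemma dotDl n (x y z : 'cV[F]_n) : dot (x + y) z = dot x z + dot y z.
Proof. by rewrite /dot [(x + y)^T]linearD mulmxDl mxE. Qed.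

Lemma dotZl n a (x z : 'cV[F]_n) : dot (a *: x) z = a * dot x z.
Proof. by rewrite /dot [(a *: x)^T]linearZ -scalemxAl mxE. Qed.

Lemma dotDr n (x y z : 'cV[F]_n) : dot z (x + y) = dot z x + dot z y.
Proof. by rewrite dotC dotDl !(dotC z). Qed.

Lemma dotZr n a (x z : 'cV[F]_n) : dot z (a *: x) = a * dot z x.
Proof. by rewrite dotC dotZl (dotC z). Qed.

Lemma dot_mull m n (M : 'M[F]_(m, n)) x y : dot (M *m x) y = dot x (M^T *m y).
Proof. by rewrite /dot trmx_mul mulmxA. Qed.

Lemma dot_ge0 n (x : 'cV[F]_n) : 0 <= dot x x.
Proof. by rewrite dotE sumr_ge0// => i _; rewrite -expr2 sqr_ge0. Qed.

Lemma l2norm_sqr n (x : 'cV[F]_n) : l2norm x ^+ 2 = dot x x.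
Proof.
rewrite /l2norm sqr_sqrtr; first by rewrite dotE; apply: eq_bigr => i _; rewrite expr2.
by rewrite sumr_ge0// => i _; rewrite sqr_ge0.
Qed.

Lemma l2norm_ge0 n (x : 'cV[F]_n) : 0 <= l2norm x.
Proof. exact: sqrtr_ge0. Qed.

Lemma l2norm0 n : l2norm (0 : 'cV[F]_n) = 0.
Proof. by apply/eqP; rewrite -sqrf_eq0 l2norm_sqr /dot mulmx0 mxE. Qed.

Lemma l2norm_eq0 n (x : 'cV[F]_n) : (l2norm x == 0) = (x == 0).
Proof.
apply/eqP/eqP => [x0|->]; last exact: l2norm0.
have : \sum_i x i 0 ^+ 2 = 0.
  apply/eqP; rewrite eq_le sumr_ge0 ?andbT; last by move=> i _; rewrite sqr_ge0.
  by rewrite -sqrtr_eq0 -/(l2norm x) x0.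
move/eqP; rewrite psumr_eq0; last by move=> i _; rewrite sqr_ge0.
move=> /allP h; apply/colP => i; rewrite mxE; apply/eqP.
by rewrite -sqrf_eq0; apply: h; rewrite mem_index_enum.
Qed.

Lemma l2normZ n a (x : 'cV[F]_n) : l2norm (a *: x) = `|a| * l2norm x.
Proof.
apply/eqP; rewrite -(@eqrXn2 _ 2) ?mulr_ge0 ?l2norm_ge0//.
by rewrite exprMn !l2norm_sqr dotZl dotZr mulrA -expr2 real_normK ?num_real.
Qed.

(** The form at $cx-by$ equals $c(ac-b^2)$, which settles $c>0$. Semidefiniteness allows $c=0$ with
    $y\neq 0$, so that case is separate. *)
Lemma psd_CauchySchwarz n (M : 'M[F]_n) (x y : 'cV[F]_n) : possemidef M ->
  dot x (M *m y) ^+ 2 <= dot x (M *m x) * dot y (M *m y).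
Proof.
move=> [sM M0]; pose a := dot x (M *m x); pose b := dot x (M *m y); pose c := dot y (M *m y).
have q s t : 0 <= s ^+ 2 * a + 2 * s * t * b + t ^+ 2 * c.
  have := M0 (s *: x + t *: y); rewrite -mulmxA -/(dot _ _).
  rewrite mulmxDr -!scalemxAr !dotDl !dotDr !dotZl !dotZr.
  have -> : dot y (M *m x) = b by rewrite dotC dot_mull sM.
  rewrite -/a -/b -/c => h; apply: le_trans h _; rewrite le_eqVlt; apply/orP; left.
  by apply/eqP; ring.
have c0 : 0 <= c by have := q 0 1; rewrite expr0n expr1n /=; lra.
have := q c (- b); have := q 1 (- b); have := q 0 1; rewrite -/a -/b -/c.
have [c00|c_gt0] := leP c 0.
  have -> : c = 0 by apply/eqP; rewrite eq_le c00.
  move=> _ _ _; have [->|bn0] := eqVneq b 0; first by rewrite expr0n mulr0.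
  (* For $c=0$ the form at $x+ty$ is affine in $t$ with slope $2b$; this $t$ brings it to $-1$. *)
  have := q 1 (- (a + 1) / (2 * b)).
  have -> : c = 0 by apply/eqP; rewrite eq_le c00.
  have -> : 1 ^+ 2 * a + 2 * 1 * (- (a + 1) / (2 * b)) * b + (- (a + 1) / (2 * b)) ^+ 2 * 0 = -1.
    by field.
  by rewrite ler0N1.
move=> _ _ h; rewrite -subr_ge0 -(pmulr_rge0 _ c_gt0).
by apply: le_trans h _; rewrite le_eqVlt; apply/orP; left; apply/eqP; ring.
Qed.

Lemma dot_le n (x y : 'cV[F]_n) : `|dot x y| <= l2norm x * l2norm y.
Proof.
have h : possemidef (1%:M : 'M[F]_n).
  split; first exact: trmx1.
  by move=> z; rewrite mulmx1; exact: dot_ge0.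
have := psd_CauchySchwarz x y h; rewrite !mul1mx -!l2norm_sqr -exprMn => h'.
rewrite -(@ler_pXn2r _ 2) ?nnegrE ?mulr_ge0 ?l2norm_ge0//.
by rewrite real_normK ?num_real.
Qed.

Lemma l2normD n (x y : 'cV[F]_n) : l2norm (x + y) <= l2norm x + l2norm y.
Proof.
rewrite -(@ler_pXn2r _ 2) ?nnegrE ?addr_ge0 ?l2norm_ge0//.
rewrite sqrrD !l2norm_sqr dotDl !dotDr (dotC y x).
have := le_trans (ler_norm _) (dot_le x y); lra.
Qed.

Lemma l2norm_sum n (I : Type) (r : seq I) (f : I -> 'cV[F]_n) :
  l2norm (\sum_(i <- r) f i) <= \sum_(i <- r) l2norm (f i).
Proof.
elim: r => [|i r IH]; first by rewrite !big_nil l2norm0.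
by rewrite !big_cons (le_trans (l2normD _ _))// lerD2l.
Qed.

(** The sum of the column norms is a crude upper bound; it only serves to make the [sup] in
    [spectral_norm] a genuine supremum. *)
Lemma spectral_has_sup m n (M : 'M[F]_(m, n)) :
  has_sup [set l2norm (M *m x) | x in [set x : 'cV[F]_n | l2norm x <= 1]].
Proof.
split; first by exists (l2norm (M *m 0)); exists 0 => //=; rewrite l2norm0 ler01.
exists (\sum_j l2norm (col j M)) => _ [x /= x1 <-].
have -> : M *m x = \sum_j x j 0 *: col j M.
  apply/colP => i; rewrite mxE summxE; apply: eq_bigr => j _.
  by rewrite !mxE mulrC.
apply: le_trans (l2norm_sum _ _) _; apply: ler_sum => j _.
rewrite l2normZ ler_piMl ?l2norm_ge0//; apply: le_trans x1.
rewrite -(@ler_pXn2r _ 2) ?nnegrE ?l2norm_ge0//.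
rewrite real_normK ?num_real// l2norm_sqr dotE (bigD1 j)//= -expr2 lerDl sumr_ge0// => i _.
by rewrite -expr2 sqr_ge0.
Qed.

Lemma l2norm_mulmx m n (M : 'M[F]_(m, n)) x : l2norm (M *m x) <= spectral_norm M * l2norm x.
Proof.
have [/eqP|x0] := eqVneq (l2norm x) 0.
  by rewrite l2norm_eq0 => /eqP ->; rewrite mulmx0 !l2norm0 mulr0.
have xp : 0 < l2norm x by rewrite lt_def x0 l2norm_ge0.
rewrite -ler_pdivrMr//.
have -> : l2norm (M *m x) / l2norm x = l2norm (M *m ((l2norm x)^-1 *: x)).
  by rewrite -scalemxAr l2normZ ger0_norm ?invr_ge0 ?l2norm_ge0// mulrC.
apply: (ub_le_sup (spectral_has_sup M).2).
by exists ((l2norm x)^-1 *: x) => //=; rewrite l2normZ ger0_norm ?invr_ge0 ?l2norm_ge0// mulVf.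
Qed.

Lemma spectral_norm_ge0 m n (M : 'M[F]_(m, n)) : 0 <= spectral_norm M.
Proof.
apply: le_trans (l2norm_ge0 (M *m 0)) _.
by apply: (ub_le_sup (spectral_has_sup M).2); exists 0 => //=; rewrite l2norm0 ler01.
Qed.

Lemma spectral_norm_le m n (M : 'M[F]_(m, n)) c :
  (forall x, l2norm x <= 1 -> l2norm (M *m x) <= c) -> spectral_norm M <= c.
Proof.
move=> h; apply: ge_sup; first exact: (spectral_has_sup M).1.
by move=> _ [x /= x1 <-]; exact: h.
Qed.

Lemma form_le m n (M : 'M[F]_(m, n)) x y :
  `|dot x (M *m y)| <= spectral_norm M * (l2norm x * l2norm y).
Proof.
apply: le_trans (dot_le _ _) _; rewrite mulrCA ler_wpM2l ?l2norm_ge0//.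
exact: l2norm_mulmx.
Qed.

End Euclidean.

(** * Positive definiteness and the smallest eigenvalue *)

Section LambdaMin.
Context {F : realType} {n : nat}.
Implicit Types (M : 'M[F]_n) (x : 'cV[F]_n).

Lemma posdef_possemidef M : posdef M -> possemidef M.
Proof.
move=> [sM pM]; split=> // x; have [->|/pM /ltW//] := eqVneq x 0.
by rewrite mulmx0 mxE.
Qed.

Lemma posdef_unit M : posdef M -> M \in unitmx.
Proof.
move=> [sM pM]; rewrite -row_free_unit; apply/row_freeP.
suff : kermx M = 0.
  by move=> /eqP; rewrite kermx_eq0 => /row_freeP.
apply/eqP/rowV0P => v /sub_kermxP vM; apply/eqP; apply: contraTT isT => v0.
have := pM v^T; rewrite trmx_eq0 trmxK vM mul0mx mxE ltxx.
by move=> /(_ v0).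
Qed.

(** Cauchy-Schwarz for the form of $M$ at $x$ and $M^{-1}x$ gives $(x\cdot x)^2\le (x\cdot
    Mx)(M^{-1}x\cdot x)$, and the last factor is at most $c\,(x\cdot x)$. No diagonalization or
    compactness is involved. *)
Lemma possemidef_unit_coercive M : possemidef M -> M \in unitmx ->
  exists2 e, 0 < e & forall x, e * dot x x <= dot x (M *m x).
Proof.
move=> pM uM; pose c := spectral_norm (invmx M) + 1.
have c0 : 0 < c by rewrite ltr_wpDl ?spectral_norm_ge0.
exists c^-1 => [|x]; first by rewrite invr_gt0.
have [x0|x0] := eqVneq (dot x x) 0.
  by rewrite x0 mulr0; have [_ h] := pM; have := h x; rewrite -mulmxA.
have xp : 0 < dot x x by rewrite lt_def x0 dot_ge0.
have b0 : 0 <= dot x (M *m x) by have [_ h] := pM; have := h x; rewrite -mulmxA.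
have hi : dot (invmx M *m x) x <= c * dot x x.
  rewrite dotC; apply: le_trans (ler_norm _) _; apply: le_trans (form_le _ _ _) _.
  by rewrite -expr2 l2norm_sqr ler_wpM2r ?dot_ge0// lerDl.
have := psd_CauchySchwarz x (invmx M *m x) pM; rewrite mulKVmx// => h.
rewrite ler_pdivrMl// -(ler_pM2l xp) -expr2 (le_trans h)//.
have -> : dot x x * (c * dot x (M *m x)) = dot x (M *m x) * (c * dot x x) by ring.
exact: ler_wpM2l.
Qed.

Lemma eigenvalue_ge M e a : (forall x, e * dot x x <= dot x (M *m x)) ->
  M^T = M -> eigenvalue M a -> e <= a.
Proof.
move=> eM sM /eigenvalueP[v vM v0].
have vv : 0 < dot v^T v^T.
  by rewrite -l2norm_sqr exprn_gt0// lt_def l2norm_ge0 l2norm_eq0 trmx_eq0 v0.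
have := eM v^T; have -> : M *m v^T = a *: v^T.
  by rewrite -[M in LHS]trmxK -trmx_mul sM vM linearZ.
by rewrite dotZr ler_pM2r.
Qed.

(* The largest [e] with [M - e] positive semidefinite is an eigenvalue:
   otherwise [M - e] is invertible, hence coercive, and [e] can be increased. *)
Lemma lambda_minP M : (0 < n)%N -> posdef M ->
  0 < lambda_min M /\ forall x, lambda_min M * dot x x <= dot x (M *m x).
Proof.
move=> n0 pdM; have psM := posdef_possemidef pdM; have sM := pdM.1.
have [e0 e0_gt0 e0M] := possemidef_unit_coercive psM (posdef_unit pdM).
pose E := [set e | forall x, e * dot x x <= dot x (M *m x)].
pose u : 'cV[F]_n := const_mx 1.
have uu : 0 < dot u u.
  rewrite -l2norm_sqr exprn_gt0// lt_def l2norm_ge0 andbT l2norm_eq0.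
  by apply/eqP => /matrixP/(_ (Ordinal n0) 0)/eqP; rewrite !mxE oner_eq0.
have supE : has_sup E.
  split; first by exists e0.
  by exists (dot u (M *m u) / dot u u) => e /(_ u); rewrite ler_pdivlMr.
pose m := sup E.
have mE : E m.
  move=> x; have [->|x0] := eqVneq (dot x x) 0.
    by rewrite mulr0; have := psM.2 x; rewrite -mulmxA.
  have xx : 0 < dot x x by rewrite lt_def x0 dot_ge0.
  rewrite -ler_pdivlMr//; apply: ge_sup; first exact: supE.1.
  by move=> e /(_ x); rewrite -ler_pdivlMr.
have e0m : e0 <= m by apply: (ub_le_sup supE.2).
have formE e x : dot x ((M - e%:M) *m x) = dot x (M *m x) - e * dot x x.
  by rewrite mulmxBl mul_scalar_mx -scaleNr dotDr dotZr mulNr.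
have eig_m : eigenvalue M m.
  apply: contraT => neig; have uM : M - m%:M \in unitmx.
    rewrite -row_free_unit -kermx_eq0; apply: contraNT neig.
    by rewrite /eigenvalue /eigenspace.
  have psm : possemidef (M - m%:M).
    split; first by rewrite linearB /= sM tr_scalar_mx.
    by move=> x; rewrite -mulmxA -/(dot _ _) formE subr_ge0; exact: mE.
  have [e e_gt0 eM] := possemidef_unit_coercive psm uM.
  have : E (m + e).
    by move=> x; have := eM x; rewrite formE mulrDl; lra.
  by move/(ub_le_sup supE.2); rewrite -/m gerDl leNgt e_gt0.
have lbE : lbound [set a | eigenvalue M a] m by move=> a; exact: eigenvalue_ge.
have lm : lambda_min M = m.
  apply/eqP; rewrite eq_le; apply/andP; split.
    by apply: ge_inf => //; exists m.
  by apply: lb_le_inf => //; exists m.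
by rewrite lm; split => //; exact: lt_le_trans e0m.
Qed.

(** There are no eigenvalues in dimension zero, and [inf] of the empty set is 0 by convention. This
    serves the degenerate case of no inputs, outside the scope of [lambda_minP]. *)
Lemma lambda_min_dim0 M : n = 0%N -> lambda_min M = 0.
Proof.
move=> n0; rewrite /lambda_min (_ : [set _ | _] = set0) ?inf0//.
apply/seteqP; split => // a /= /eigenvalueP[v _].
by move/eqP; case; apply/rowP => i; have := ltn_ord i; rewrite {2}n0.
Qed.

End LambdaMin.

(** * Responses and the quadratic cost *)

Section Response.
Context {F : realType} {nx nu : nat}.
Implicit Types (A Q : 'M[F]_nx) (B : 'M[F]_(nx, nu)) (R : 'M[F]_nu) (S : 'M[F]_(nu, nx)).

(** Columns are independent noise-free trajectories. [X0 = 1%:M] with [U = padded L] gives the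
    impulse response from noise to state; a single column gives the trajectories used in the
    estimates. *)
Fixpoint response A B m (X0 : 'M[F]_(nx, m)) (U : nat -> 'M[F]_(nu, m)) (k : nat) :
    'M[F]_(nx, m) :=
  if k is k'.+1 then A *m response A B X0 U k' + B *m U k' else X0.

(* The polarization of the stage cost, summed over columns. *)
Definition cost_form Q R S m (X : 'M[F]_(nx, m)) (U : 'M[F]_(nu, m))
    (Y : 'M[F]_(nx, m)) (V : 'M[F]_(nu, m)) : F :=
  \tr (X^T *m Q *m Y + U^T *m R *m V + V^T *m S *m X + U^T *m S *m Y).

Definition padded H (L : 'I_H -> 'M[F]_(nu, nx)) (k : nat) : 'M[F]_(nu, nx) :=
  if insub k is Some i then L i else 0.

End Response.

Section Response.
Context {F : realType} {nx nu : nat} (A : 'M[F]_nx) (B : 'M[F]_(nx, nu)).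

Lemma response_lin m (X Y : 'M[F]_(nx, m)) (U V : nat -> 'M[F]_(nu, m)) a k :
  response A B (X + a *: Y) (fun k => U k + a *: V k) k =
  response A B X U k + a *: response A B Y V k.
Proof.
elim: k => //= k ->; rewrite !mulmxDr -!scalemxAr scalerDr -!addrA; congr (_ + _).
by rewrite addrCA.
Qed.

Lemma response_mulr m p (X : 'M[F]_(nx, m)) (U : nat -> 'M[F]_(nu, m)) (W : 'M[F]_(m, p)) k :
  response A B (X *m W) (fun k => U k *m W) k = response A B X U k *m W.
Proof. by elim: k => //= k ->; rewrite mulmxDl !mulmxA. Qed.

Lemma response0E m (U : nat -> 'M[F]_(nu, m)) k :
  response A B 0 U k = \sum_(j < k) A ^+ (k.-1 - j) *m B *m U j.
Proof.
elim: k => [|k IH] /=; first by rewrite big_ord0.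
rewrite big_ord_recr /= subnn IH; congr (_ + _); last by rewrite mul1mx.
rewrite mulmx_sumr; apply: eq_bigr => j _; rewrite !mulmxA; congr (_ *m _ *m _).
by rewrite -[LHS](exprS A); congr (A ^+ _); have := ltn_ord j; lia.
Qed.

Lemma response_free m (X : 'M[F]_(nx, m)) (U : nat -> 'M[F]_(nu, m)) H k :
  (forall j, (H <= j)%N -> U j = 0) ->
  response A B X U (H + k) = A ^+ k *m response A B X U H.
Proof.
move=> U0; elim: k => [|k IH]; first by rewrite addn0 mul1mx.
rewrite addnS /= IH U0 ?leq_addr// mulmx0 addr0 mulmxA; congr (_ *m _).
exact/esym/(exprS A).
Qed.

Lemma eq_response m (X : 'M[F]_(nx, m)) (U V : nat -> 'M[F]_(nu, m)) k :
  U =1 V -> response A B X U k = response A B X V k.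
Proof. by move=> UV; elim: k => //= k ->; rewrite UV. Qed.

End Response.

(** * Algebra and coercivity of the cost form *)

Section CostForm.
Context {F : realType} {nx nu : nat} (Q : 'M[F]_nx) (R : 'M[F]_nu) (S : 'M[F]_(nu, nx)).
Local Notation form := (cost_form Q R S).

Lemma cost_formE (x y : 'cV[F]_nx) (u v : 'cV[F]_nu) :
  form x u y v = dot x (Q *m y) + dot u (R *m v) + dot v (S *m x) + dot u (S *m y).
Proof. by rewrite /cost_form trace_mx11 /dot !mulmxA !mxE. Qed.

Lemma cost_form_linl m (X X' Y : 'M[F]_(nx, m)) (U U' V : 'M[F]_(nu, m)) a :
  form (X + a *: X') (U + a *: U') Y V = form X U Y V + a * form X' U' Y V.
Proof.
rewrite /cost_form ![(_ + _)^T]linearD /= ![(_ *: _)^T]linearZ /=.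
rewrite ?mulmxDl -?scalemxAl ?mulmxDr -?scalemxAr ?mulmxDl -?scalemxAl.
by rewrite !linearD /= !linearZ /=; ring.
Qed.

Lemma cost_form_linr m (X Y Y' : 'M[F]_(nx, m)) (U V V' : 'M[F]_(nu, m)) a :
  form X U (Y + a *: Y') (V + a *: V') = form X U Y V + a * form X U Y' V'.
Proof.
rewrite /cost_form ![(_ + _)^T]linearD /= ![(_ *: _)^T]linearZ /=.
rewrite ?mulmxDl -?scalemxAl ?mulmxDr -?scalemxAr ?mulmxDl -?scalemxAl.
by rewrite !linearD /= !linearZ /=; ring.
Qed.

Lemma cost_form0l m (Y : 'M[F]_(nx, m)) (V : 'M[F]_(nu, m)) : form 0 0 Y V = 0.
Proof. by rewrite /cost_form !trmx0 !mulmx0 !mul0mx !addr0 linear0. Qed.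

(** Cyclicity of the trace moves $z$ to the other pair of arguments. This is the passage from the
    trace form to the form on vectors. *)
Lemma cost_form_rank1 m (X : 'M[F]_(nx, m)) (U : 'M[F]_(nu, m)) (y : 'cV[F]_nx)
    (v : 'cV[F]_nu) (z : 'cV[F]_m) :
  form X U (y *m z^T) (v *m z^T) = form (X *m z) (U *m z) y v.
Proof.
rewrite /cost_form !linearD /= !trmx_mul !trmxK.
rewrite 3!(mulmxA _ _ z^T) ![\tr (_ *m z^T)]mxtrace_mulC !mulmxA; congr (_ + _ + _).
by rewrite -!mulmxA mxtrace_mulC !mulmxA.
Qed.

Lemma cost_form_cols m (X Y : 'M[F]_(nx, m)) (U V : 'M[F]_(nu, m)) :
  form X U Y V = \sum_i form (col i X) (col i U) (col i Y) (col i V).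
Proof.
rewrite /cost_form /mxtrace; apply: eq_bigr => i _; rewrite big_ord1.
have E p q (M : 'M[F]_(p, q)) (W : 'M[F]_(p, m)) (Z : 'M[F]_(q, m)) :
    (W^T *m M *m Z) i i = ((col i W)^T *m M *m col i Z) 0 0.
  rewrite -mulmxA -[in RHS]mulmxA !mxE; apply: eq_bigr => j _; rewrite !mxE; congr (_ * _).
  by apply: eq_bigr => k _; rewrite !mxE.
have addE p q (N N' : 'M[F]_(p, q)) j k : (N + N') j k = N j k + N' j k by rewrite mxE.
by rewrite !addE !E.
Qed.

Hypotheses (symQ : Q^T = Q) (symR : R^T = R).

Lemma cost_formC m (X Y : 'M[F]_(nx, m)) (U V : 'M[F]_(nu, m)) :
  form X U Y V = form Y V X U.
Proof.
rewrite /cost_form !linearD /= -(mxtrace_tr (Y^T *m Q *m X)) -(mxtrace_tr (V^T *m R *m U)).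
by rewrite !trmx_mul !trmxK symQ symR !mulmxA; ring.
Qed.

Lemma cost_form_quad m (X Y : 'M[F]_(nx, m)) (U V : 'M[F]_(nu, m)) a :
  form (X + a *: Y) (U + a *: V) (X + a *: Y) (U + a *: V) =
  form X U X U + 2 * a * form X U Y V + a ^+ 2 * form Y V Y V.
Proof. by rewrite cost_form_linl !cost_form_linr (cost_formC Y X); ring. Qed.

Hypothesis pdQ : posdef Q.
Local Notation N := (R - S *m invmx Q *m S^T).

(** Completing the square in $x$; the remainder is the Schur complement of $Q$ in the block
    weight. *)
Lemma cost_form_squares (x : 'cV[F]_nx) (u : 'cV[F]_nu) :
  let z := x + invmx Q *m S^T *m u in
  form x u x u = dot z (Q *m z) + dot u (N *m u).
Proof.
move=> z; have uQ := posdef_unit pdQ; pose h := invmx Q *m (S^T *m u).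
have Qh : Q *m h = S^T *m u by rewrite mulKVmx.
have Nu : N *m u = R *m u - S *m h by rewrite mulmxBl -!mulmxA.
have uS y : dot u (S *m y) = dot (S^T *m u) y by rewrite dot_mull trmxK.
rewrite cost_formE Nu /z -mulmxA -/h mulmxDr Qh !dotDl !dotDr -[- (S *m h)]scaleN1r dotZr.
have -> : dot h (Q *m x) = dot (S^T *m u) x by rewrite -Qh dot_mull symQ.
by rewrite !uS (dotC x (_ *m u)) (dotC h); ring.
Qed.

Lemma schur_posdef : posdef (block_mx Q S^T S R) -> posdef N.
Proof.
move=> [_ pos]; have uQ := posdef_unit pdQ; split.
  by rewrite linearB /= symR !trmx_mul trmxK trmx_inv symQ mulmxA.
(* The minimizer in $x$ for given $u$: the first square vanishes there and only the Schur complement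
   remains. *)
move=> u u0; pose x := - (invmx Q *m S^T *m u).
have xu0 : col_mx x u != 0 by rewrite col_mx_eq0 (negbTE u0) andbF.
have := pos _ xu0; rewrite tr_col_mx mul_row_block mul_row_col.
have -> : ((x^T *m Q + u^T *m S) *m x + (x^T *m S^T + u^T *m R) *m u) 0 0 = form x u x u.
  rewrite cost_formE !mulmxDl /dot -!mulmxA.
  have addE (M M' : 'M[F]_1) : (M + M') 0 0 = M 0 0 + M' 0 0 by rewrite mxE.
  rewrite !addE -!/(dot _ _).
  have -> : dot x (S^T *m u) = dot u (S *m x) by rewrite dotC dot_mull trmxK.
  by ring.
by rewrite cost_form_squares /x addNr mulmx0 /dot mulmx0 mxE add0r mulmxA.
Qed.

Lemma cost_form_ge (x : 'cV[F]_nx) (u : 'cV[F]_nu) : (0 < nu)%N ->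
  posdef (block_mx Q S^T S R) -> lambda_min N * dot u u <= form x u x u.
Proof.
move=> nu0 pd; rewrite cost_form_squares.
have [_ h] := lambda_minP nu0 (schur_posdef pd).
apply: le_trans (h u) _; rewrite lerDr.
by have [_ h'] := posdef_possemidef pdQ; have := h' (x + invmx Q *m S^T *m u); rewrite -mulmxA.
Qed.

Lemma cost_form_ge0 m (X : 'M[F]_(nx, m)) (U : 'M[F]_(nu, m)) :
  posdef (block_mx Q S^T S R) -> 0 <= form X U X U.
Proof.
move=> pd; rewrite cost_form_cols sumr_ge0// => i _; rewrite cost_form_squares.
rewrite addr_ge0//.
  have [_ h] := posdef_possemidef pdQ.
  by have := h (col i X + invmx Q *m S^T *m col i U); rewrite -mulmxA.
have [_ h] := posdef_possemidef (schur_posdef pd).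
by have := h (col i U); rewrite -mulmxA.
Qed.

End CostForm.

(** * Stationarity of the Riccati feedback *)

Section Riccati.
Context {F : realType} {nx nu : nat}.
Variables (A Q P : 'M[F]_nx) (B : 'M[F]_(nx, nu)) (R : 'M[F]_nu) (S : 'M[F]_(nu, nx)).
Hypotheses (symQ : Q^T = Q) (pdR : posdef R) (psP : possemidef P) (dareP : dare_solution A B Q R S P).
Local Notation K := (lqr_gain A B R S P).
Local Notation G := (R + B^T *m P *m B).

Lemma riccati_weight_unit : G \in unitmx.
Proof.
apply: posdef_unit; split.
  by rewrite linearD /= pdR.1 !trmx_mul trmxK psP.1 mulmxA.
move=> x x0; rewrite mulmxDr mulmxDl mxE ltr_wpDr ?pdR.2//.
by have := psP.2 (B *m x); rewrite trmx_mul !mulmxA.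
Qed.

(** The defining equation $GK=-(B^\top PA+S)$ rearranged: the derivative of stage cost plus
    cost-to-go with respect to the input vanishes at $u=Kx$. *)
Lemma lqr_gain_stationary : R *m K + S = - (B^T *m P *m (A + B *m K)).
Proof.
have : G *m K = - (B^T *m P *m A + S) by rewrite mulmxN mulKVmx ?riccati_weight_unit.
rewrite mulmxDl => GK; have -> : R *m K = - (B^T *m P *m A + S) - B^T *m P *m B *m K.
  by rewrite -GK addrK.
by rewrite mulmxDr !mulmxA !opprD addrAC subrK.
Qed.

Lemma riccati_lqr_gain : Q + S^T *m K = P - A^T *m P *m (A + B *m K).
Proof.
have PE : P = A^T *m P *m A + (A^T *m P *m B + S^T) *m K + Q.
  by rewrite {1}dareP /lqr_gain [in RHS]mulmxN mulmxA.
move: PE; set K := lqr_gain _ _ _ _ _ => PE; rewrite {1}PE.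
rewrite mulmxDr mulmxDl !mulmxA [_ *m A + (_ + _)]addrA.
by rewrite [RHS]addrC -(addrA (_ *m A + _)) addKr addrC.
Qed.

(** The two preceding identities, tested against $y$ and $v$. The right-hand side is the pairing of
    $Px$ with $y$ now minus the same pairing one step later, so it telescopes along the closed loop
    for every perturbing input $v$. *)
Lemma riccati_step (x y : 'cV[F]_nx) (v : 'cV[F]_nu) :
  cost_form Q R S x (K *m x) y v =
  dot (P *m x) y - dot (P *m ((A + B *m K) *m x)) (A *m y + B *m v).
Proof.
have e1 : dot ((Q + S^T *m K) *m x) y = dot (Q *m x) y + dot (K *m x) (S *m y).
  by rewrite mulmxDl dotDl -(mulmxA S^T) (dot_mull S^T) trmxK.
have e2 : dot ((R *m K + S) *m x) v = dot (K *m x) (R *m v) + dot v (S *m x).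
  by rewrite mulmxDl dotDl -mulmxA dot_mull pdR.1 (dotC v).
have e3 : dot x (Q *m y) = dot (Q *m x) y by rewrite dot_mull symQ.
have -> : cost_form Q R S x (K *m x) y v =
    dot ((Q + S^T *m K) *m x) y + dot ((R *m K + S) *m x) v.
  by rewrite cost_formE e1 e2 e3; ring.
rewrite riccati_lqr_gain lqr_gain_stationary mulmxBl mulNmx dotDr.
have dotN n (a b : 'cV[F]_n) : dot (- a) b = - dot a b by rewrite -scaleN1r dotZl mulN1r.
by rewrite dotDl !dotN -!(mulmxA _^T) !(dot_mull _^T) !trmxK !mulmxA; ring.
Qed.

End Riccati.

(** * Decay estimates *)

Section Geometric.
Context {F : realType}.
Implicit Types q : F.

Lemma geometric_sum_le q n : 0 <= q -> q < 1 -> \sum_(k < n) q ^+ k <= (1 - q)^-1.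
Proof.
move=> q0 q1; rewrite -[leRHS]mul1r ler_pdivlMr ?subr_gt0//.
suff -> : (\sum_(k < n) q ^+ k) * (1 - q) = 1 - q ^+ n by rewrite gerBl exprn_ge0.
elim: n => [|n IH]; first by rewrite big_ord0 mul0r expr0 subrr.
by rewrite big_ord_recr /= mulrDl IH exprS; ring.
Qed.

(** Multiplication by $1-q$ turns the sum into a geometric one minus a nonnegative term. The
    predecessor at $k=0$ is harmless, since its coefficient is 0. *)
Lemma arith_geometric_sum_le q n : 0 <= q -> q < 1 ->
  \sum_(k < n) k%:R * q ^+ k.-1 <= (1 - q)^-1 ^+ 2.
Proof.
move=> q0 q1; have q1' : 0 < 1 - q by rewrite subr_gt0.
rewrite expr2 ler_pdivlMr//; apply: le_trans (geometric_sum_le n q0 q1).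
case: n => [|n]; first by rewrite !big_ord0 mul0r.
suff -> : (\sum_(k < n.+1) k%:R * q ^+ k.-1) * (1 - q) =
    \sum_(k < n) q ^+ k - n%:R * q ^+ n.
  rewrite big_ord_recr /= -[leRHS]subr0 -subr_ge0.
  have := mulr_ge0 (ler0n F n) (exprn_ge0 n q0); have := exprn_ge0 n q0; lra.
elim: n => [|n IH]; first by rewrite big_ord_recr !big_ord0 /=; ring.
by rewrite big_ord_recr /= mulrDl IH big_ord_recr /= exprS -natr1; ring.
Qed.

Lemma real_CauchySchwarz n (a b : 'I_n -> F) :
  \sum_i a i * b i <= Num.sqrt (\sum_i a i ^+ 2) * Num.sqrt (\sum_i b i ^+ 2).
Proof.
have -> : \sum_i a i * b i = dot (\col_i a i) (\col_i b i).
  by rewrite dotE; apply: eq_bigr => i _; rewrite !mxE.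
apply: le_trans (le_trans (ler_norm _) (dot_le _ _)) _.
rewrite /l2norm le_eqVlt; apply/orP; left; apply/eqP.
by congr (Num.sqrt _ * Num.sqrt _); apply: eq_bigr => i _; rewrite mxE.
Qed.

End Geometric.

Section Decay.
Context {F : realType} {nx nu : nat}.
Variables (A : 'M[F]_nx) (B : 'M[F]_(nx, nu)) (tau e : F).
Hypotheses (tau_ge0 : 0 <= tau) (e_gt0 : 0 < e) (e_lt1 : e < 1).
Hypothesis decA : forall k, spectral_norm (A ^+ k) <= tau * e ^+ k.
Local Notation q := (e ^+ 2).

Lemma decay_ratio : 0 <= q < 1.
Proof. by rewrite sqr_ge0 expr_lt1// ltW. Qed.

Lemma decay_mulmx k (x : 'cV[F]_nx) : l2norm (A ^+ k *m x) <= tau * e ^+ k * l2norm x.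
Proof. by apply: le_trans (l2norm_mulmx _ _) _; rewrite ler_wpM2r ?l2norm_ge0. Qed.

Lemma decay_input k (u : 'cV[F]_nu) :
  l2norm (A ^+ k *m B *m u) <= tau * e ^+ k * spectral_norm B * l2norm u.
Proof.
rewrite -mulmxA; apply: le_trans (decay_mulmx _ _) _; rewrite -[leRHS]mulrA.
by rewrite ler_wpM2l ?l2norm_mulmx// mulr_ge0// exprn_ge0// ltW.
Qed.

(** Cauchy-Schwarz in time between the weights $e^{H-1-j}$ and the norms of the inputs. The bound is
    in terms of the l2 size of the input because that is what coercivity controls. *)
Lemma response_bound_l2 H m (u : nat -> 'cV[F]_nu) : (forall k, (H <= k)%N -> u k = 0) ->
  l2norm (response A B 0 u (H + m)) <=
  tau * spectral_norm B * e ^+ m *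
    (Num.sqrt (\sum_(k < H) l2norm (u k) ^+ 2) / Num.sqrt (1 - q)).
Proof.
move=> u0; have [q0 q1] := andP decay_ratio.
have c0 : 0 <= tau * spectral_norm B * e ^+ m.
  by rewrite !mulr_ge0 ?spectral_norm_ge0 ?exprn_ge0 ?(ltW e_gt0).
rewrite response0E big_split_ord /= [X in _ + X]big1 ?addr0; last first.
  by move=> j _; rewrite u0 ?leq_addr// mulmx0.
apply: le_trans (l2norm_sum _ _) _.
apply: (@le_trans _ _ (tau * spectral_norm B * e ^+ m *
    \sum_(j < H) e ^+ (H.-1 - j) * l2norm (u j))).
  rewrite mulr_sumr; apply: ler_sum => j _; apply: le_trans (decay_input _ _) _.
  have -> : ((H + m).-1 - j = m + (H.-1 - j))%N by have := ltn_ord j; lia.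
  by rewrite exprD le_eqVlt; apply/orP; left; apply/eqP; ring.
rewrite ler_wpM2l//; apply: le_trans (real_CauchySchwarz _ _) _.
rewrite mulrC ler_wpM2l ?sqrtr_ge0// -sqrtrV ?subr_ge0 ?(ltW q1)// ler_wsqrtr//.
apply: le_trans (geometric_sum_le H q0 q1).
rewrite (reindex_inj rev_ord_inj) /= le_eqVlt; apply/orP; left; apply/eqP.
apply: eq_bigr => j _; rewrite -!exprM mulnC; congr (_ ^+ (2 * _)).
by have := ltn_ord j; lia.
Qed.

(** Input and impulse response decay at the same rate, so all $m$ terms of the convolution have the
    same bound $e^{H+m-1}$ up to constants; hence the factor $m$. *)
Lemma response_bound_geometric H m (u : nat -> 'cV[F]_nu) c :
  (forall k, (k < H)%N -> u k = 0) ->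
  (forall k, l2norm (u (H + k)%N) <= c * e ^+ (H + k)) ->
  l2norm (response A B 0 u (H + m)) <=
  m%:R * (tau * spectral_norm B * c * e ^+ (H + m.-1)).
Proof.
move=> u0 uc; rewrite response0E big_split_ord /= big1 ?add0r; last first.
  by move=> j _; rewrite u0// mulmx0.
apply: le_trans (l2norm_sum _ _) _.
rewrite [leRHS]mulr_natl -[X in _ *+ X]card_ord -sumr_const.
apply: ler_sum => j _; apply: le_trans (decay_input _ _) _.
have -> : ((H + m).-1 - (H + j) = m.-1 - j)%N by have := ltn_ord j; lia.
have c0 : 0 <= tau * e ^+ (m.-1 - j) * spectral_norm B.
  by rewrite !mulr_ge0 ?spectral_norm_ge0 ?exprn_ge0 ?(ltW e_gt0).
apply: le_trans (ler_wpM2l c0 (uc j)) _.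
have -> : (H + m.-1 = m.-1 - j + (H + j))%N by have := ltn_ord j; lia.
by rewrite (exprD _ (m.-1 - j)) le_eqVlt; apply/orP; left; apply/eqP; ring.
Qed.

End Decay.

(** * Convergence of cost sums and the cross term *)

Section CostSums.
Context {F : realType} {nx nu : nat}.
Variables (A Q : 'M[F]_nx) (B : 'M[F]_(nx, nu)) (R : 'M[F]_nu) (S : 'M[F]_(nu, nx)).
Variables (tau e : F).
Hypotheses (tau_ge0 : 0 <= tau) (e_gt0 : 0 < e) (e_lt1 : e < 1).
Hypothesis decA : forall k, spectral_norm (A ^+ k) <= tau * e ^+ k.
Local Notation q := (e ^+ 2).
Local Notation form := (cost_form Q R S).

Lemma free_cost_le k (x : 'cV[F]_nx) :
  dot (A ^+ k *m x) (Q *m (A ^+ k *m x)) <= spectral_norm Q * (tau * l2norm x) ^+ 2 * q ^+ k.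
Proof.
apply: le_trans (ler_norm _) _; apply: le_trans (form_le _ _ _) _.
rewrite -mulrA ler_wpM2l ?spectral_norm_ge0// -expr2 -exprM mulnC exprM -exprMn.
rewrite lerXn2r ?nnegrE ?l2norm_ge0//.
  by rewrite !mulr_ge0 ?l2norm_ge0 ?exprn_ge0 ?(ltW e_gt0).
by rewrite mulrAC; exact: decay_mulmx.
Qed.

(** For $x=x_0$ this is the contribution of the initial state, which therefore drops out of the
    average cost. *)
Lemma cvg_free_cost (x : 'cV[F]_nx) : posdef Q ->
  (fun k => stage_cost Q R S (A ^+ k *m x) 0) @ \oo --> 0.
Proof.
move=> pdQ.
have stageE k : stage_cost Q R S (A ^+ k *m x) 0 = dot (A ^+ k *m x) (Q *m (A ^+ k *m x)).
  by rewrite /stage_cost trmx0 !mul0mx scaler0 !addr0 /dot (mulmxA _ Q).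
have [q0 q1] := andP (decay_ratio e_gt0 e_lt1).
have cq : (fun k => spectral_norm Q * (tau * l2norm x) ^+ 2 * q ^+ k) @ \oo --> 0.
  rewrite -[X in _ --> X](mulr0 (spectral_norm Q * (tau * l2norm x) ^+ 2)).
  by apply: cvgM; [exact: cvg_cst|apply: cvg_expr; rewrite ger0_norm].
apply: (squeeze_cvgr _ (cvg_cst 0) cq); apply: nearW => k /=.
rewrite stageE free_cost_le andbT.
by have [_ h] := posdef_possemidef pdQ; have := h (A ^+ k *m x); rewrite -mulmxA.
Qed.

(** The partial sums increase, and once the input stops at $H$ the state evolves freely, so the
    remaining costs are dominated by a geometric series. *)
Lemma cost_sum_cvg m (X : 'M[F]_(nx, m)) (U : nat -> 'M[F]_(nu, m)) H :
  R^T = R -> posdef Q -> posdef (block_mx Q S^T S R) ->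
  (forall k, (H <= k)%N -> U k = 0) ->
  cvgn (fun T => \sum_(k < T) form (response A B X U k) (U k) (response A B X U k) (U k)).
Proof.
move=> symR pdQ pd U0.
pose c k := form (response A B X U k) (U k) (response A B X U k) (U k).
have c0 k : 0 <= c k by apply: (cost_form_ge0 (proj1 pdQ)).
have [q0 q1] := andP (decay_ratio e_gt0 e_lt1).
pose C := \sum_i spectral_norm Q * (tau * l2norm (col i (response A B X U H))) ^+ 2.
have cH k : c (H + k)%N <= C * q ^+ k.
  rewrite /c (response_free _ _ _ _ U0) U0 ?leq_addr// cost_form_cols mulr_suml.
  apply: ler_sum => i _.
  have -> : col i (A ^+ k *m response A B X U H) = A ^+ k *m col i (response A B X U H).
    by rewrite !colE mulmxA.
  have -> : col i (0 : 'M[F]_(nu, m)) = 0 by apply/colP => j; rewrite !mxE.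
  by rewrite cost_formE !dot0l !addr0; exact: free_cost_le.
have mono : nondecreasing_seq (fun T => \sum_(k < T) c k).
  by apply/nondecreasing_seqP => n; rewrite big_ord_recr /= lerDl.
apply: nondecreasing_is_cvgn => //.
exists (\sum_(k < H) c k + C * (1 - q)^-1) => _ [T _ <-].
apply: (@le_trans _ _ (\sum_(k < H + T) c k)); first by apply: mono; rewrite leq_addl.
rewrite big_split_ord /= lerD2l.
apply: (@le_trans _ _ (\sum_(k < T) C * q ^+ k)); first by apply: ler_sum => k _.
rewrite -mulr_sumr ler_wpM2l ?geometric_sum_le//.
by apply: sumr_ge0 => i _; rewrite mulr_ge0 ?spectral_norm_ge0 ?sqr_ge0.
Qed.

Lemma response_eq0 m (U : nat -> 'M[F]_(nu, m)) H k :
  (forall j, (j < H)%N -> U j = 0) -> (k <= H)%N -> response A B 0 U k = 0.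
Proof.
move=> U0 kH; rewrite response0E big1// => j _.
by rewrite U0 ?mulmx0//; apply: leq_trans kH.
Qed.

(** The supports of [u] and [v] are disjoint. Before [H] the input [u] and its response vanish; from
    [H] on [v] vanishes, which leaves the $Q$ term between the two states and the $S$ term pairing
    [u] with the response of [v]. *)
Lemma cross_cost_le H M (u v : nat -> 'cV[F]_nu) c :
  0 <= c ->
  (forall k, (k < H)%N -> u k = 0) ->
  (forall k, l2norm (u (H + k)%N) <= c * e ^+ (H + k)) ->
  (forall k, (H <= k)%N -> v k = 0) ->
  \sum_(k < H + M) form (response A B 0 u k) (u k) (response A B 0 v k) (v k) <=
  e ^+ H * (Num.sqrt (\sum_(k < H) l2norm (v k) ^+ 2) / Num.sqrt (1 - q)) * c *
  ((tau * spectral_norm B) ^+ 2 * spectral_norm Q * (1 - q)^-1 ^+ 2 +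
   tau * spectral_norm B * spectral_norm S * (1 - q)^-1).
Proof.
move=> c0 u0 uc v0; have [q0 q1] := andP (decay_ratio e_gt0 e_lt1).
set Y := _ / _; set b := spectral_norm B.
have b0 : 0 <= b := spectral_norm_ge0 _.
have Y0 : 0 <= Y by rewrite divr_ge0 ?sqrtr_ge0.
have e0 : 0 <= e := ltW e_gt0.
rewrite big_split_ord /= big1 ?add0r; last first.
  move=> k _; have uk : u k = 0 by exact: u0.
  have zk : response A B 0 u k = 0 by apply: (response_eq0 u0); exact: ltnW.
  by rewrite uk zk cost_form0l.
pose g k := (tau * b) ^+ 2 * spectral_norm Q * (k%:R * q ^+ k.-1) +
  tau * b * spectral_norm S * q ^+ k.
apply: (@le_trans _ _ (\sum_(k < M) e ^+ H * Y * c * g k)).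
  apply: ler_sum => k _; rewrite cost_formE v0 ?leq_addr// mulmx0.
  rewrite (dotC (u _) 0) !dot0l !addr0 /g mulrDr.
  have yb := response_bound_l2 B tau_ge0 e_gt0 e_lt1 decA k v0.
  have zb := response_bound_geometric B tau_ge0 e_gt0 e_lt1 decA k u0 uc.
  rewrite -/Y -/b in yb zb.
  apply: lerD; apply: le_trans (ler_norm _) _; apply: le_trans (form_le _ _ _) _.
    apply: (@le_trans _ _ (spectral_norm Q * (k%:R * (tau * b * c * e ^+ (H + k.-1)) *
        (tau * b * e ^+ k * Y)))).
      by rewrite ler_wpM2l ?spectral_norm_ge0// ler_pM ?l2norm_ge0.
    case: (k : nat) => [|j]; first by rewrite !mul0r !mulr0.
    (* The left-hand side carries one more factor $e\le 1$, which is given up. *)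
    have ej : e ^+ (H + j) * e ^+ j.+1 <= e ^+ H * q ^+ j.
      have -> : e ^+ (H + j) * e ^+ j.+1 = e * (e ^+ H * q ^+ j).
        by rewrite -exprM mul2n -addnn exprS !exprD; ring.
      by rewrite ler_piMl ?(ltW e_lt1)// mulr_ge0 ?exprn_ge0.
    have d0 : 0 <= spectral_norm Q * j.+1%:R * (tau * b) ^+ 2 * c * Y.
      by rewrite !mulr_ge0 ?sqr_ge0 ?spectral_norm_ge0.
    apply: le_trans (le_trans (ler_wpM2l d0 ej) _); rewrite le_eqVlt; apply/orP; left;
    by apply/eqP => /=; ring.
  apply: (@le_trans _ _ (spectral_norm S * (c * e ^+ (H + k) * (tau * b * e ^+ k * Y)))).
    by rewrite ler_wpM2l ?spectral_norm_ge0// ler_pM ?l2norm_ge0.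
  rewrite -exprM mul2n -addnn !exprD le_eqVlt; apply/orP; left; apply/eqP; ring.
rewrite -mulr_sumr ler_wpM2l ?mulr_ge0 ?exprn_ge0// /g big_split /= -!mulr_sumr.
apply: lerD; apply: ler_wpM2l; rewrite ?mulr_ge0 ?sqr_ge0 ?spectral_norm_ge0//.
  exact: arith_geometric_sum_le.
exact: geometric_sum_le.
Qed.

End CostSums.

(** * The gap to the infinite-horizon gains, applied to a fixed vector *)

Section FirstGain.
Context {F : realType} {nx nu : nat}.
Variables (A Q P : 'M[F]_nx) (B : 'M[F]_(nx, nu)) (R : 'M[F]_nu) (S : 'M[F]_(nu, nx)).
Variables (tau e : F) (H : nat) (L : 'I_H -> 'M[F]_(nu, nx)).
Hypotheses (tau_ge0 : 0 <= tau) (e_gt0 : 0 < e) (e_lt1 : e < 1).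
Hypotheses (pdQ : posdef Q) (pdR : posdef R) (pdW : posdef (block_mx Q S^T S R)).
Hypotheses (psP : possemidef P) (dareP : dare_solution A B Q R S P).
Local Notation K := (lqr_gain A B R S P).
Local Notation AK := (A + B *m K).
Hypothesis decA : forall k, spectral_norm (A ^+ k) <= tau * e ^+ k.
Hypothesis decAK : forall k, spectral_norm (AK ^+ k) <= tau * e ^+ k.
Local Notation q := (e ^+ 2).
Local Notation form := (cost_form Q R S).
Local Notation lambda := (lambda_min (R - S *m invmx Q *m S^T)).

Variable v : 'cV[F]_nx.

Definition gain_gap (k : nat) : 'cV[F]_nu :=
  if (k < H)%N then padded L k *m v - K *m (AK ^+ k *m v) else 0.
Local Notation D := (Num.sqrt (\sum_(k < H) l2norm (gain_gap k) ^+ 2)).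

Let tail k : 'cV[F]_nu := if (k < H)%N then 0 else K *m (AK ^+ k *m v).
Let y := response A B 0 gain_gap.

Lemma response_lqr k : response A B v (fun k => K *m (AK ^+ k *m v)) k = AK ^+ k *m v.
Proof.
elim: k => [|k IH]; first by rewrite mul1mx.
have -> : AK ^+ k.+1 = AK *m AK ^+ k := exprS AK k.
by rewrite /= IH !mulmxA -!mulmxDl.
Qed.

Lemma lqr_stationary T :
  \sum_(k < T) form (AK ^+ k *m v) (K *m (AK ^+ k *m v)) (y k) (gain_gap k) =
  - dot (P *m (AK ^+ T *m v)) (y T).
Proof.
elim: T => [|T IH]; first by rewrite big_ord0 /y /= /dot mulmx0 mxE oppr0.
rewrite big_ord_recr /= IH (riccati_step pdQ.1 pdR psP dareP) addKr.
by have -> : AK ^+ T.+1 = AK *m AK ^+ T := exprS AK T; rewrite !mulmxA.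
Qed.

(** The input of [L] is the optimal input plus the gap minus the tail: below [H] the tail is 0, and
    from [H] on the gap is 0 and the tail cancels the optimal input. Linearity in the first pair of
    arguments and telescoping give the three terms. *)
Lemma gap_decomposition T :
  \sum_(k < T) form (response A B v (fun k => padded L k *m v) k) (padded L k *m v)
    (y k) (gain_gap k) =
  - dot (P *m (AK ^+ T *m v)) (y T)
  + \sum_(k < T) form (y k) (gain_gap k) (y k) (gain_gap k)
  - \sum_(k < T) form (response A B 0 tail k) (tail k) (y k) (gain_gap k).
Proof.
rewrite -lqr_stationary -sumrN -!big_split /=; apply: eq_bigr => k _.
have inE j : padded L j *m v =
    (K *m (AK ^+ j *m v) + 1 *: gain_gap j) + (-1) *: tail j.
  rewrite /gain_gap /tail scale1r scaleN1r; case: ifPn => [_|jH].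
    by rewrite oppr0 addr0 addrC subrK.
  by rewrite addr0 subrr /padded insubF ?mul0mx// (negbTE jH).
have -> : response A B v (fun k => padded L k *m v) k =
    (AK ^+ k *m v + 1 *: y k) + (-1) *: response A B 0 tail k.
  rewrite (eq_response _ _ _ _ inE).
  have := response_lin A B (v + 1 *: 0) 0
    (fun j => K *m (AK ^+ j *m v) + 1 *: gain_gap j) tail (-1) k.
  rewrite (response_lin A B v 0 (fun j => K *m (AK ^+ j *m v)) gain_gap 1 k).
  by rewrite response_lqr !scaler0 !addr0.
by rewrite inE !cost_form_linl mul1r mulN1r.
Qed.

Lemma gap_bound : (0 < nu)%N -> l2norm v <= 1 ->
  (fun T => \sum_(k < T) form (response A B v (fun k => padded L k *m v) k)
    (padded L k *m v) (y k) (gain_gap k)) @ \oo --> 0 ->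
  lambda * D <= e ^+ H / Num.sqrt (1 - q) * (spectral_norm K * tau) *
    ((tau * spectral_norm B) ^+ 2 * spectral_norm Q * (1 - q)^-1 ^+ 2 +
     tau * spectral_norm B * spectral_norm S * (1 - q)^-1).
Proof.
move=> nu0 v1 stat; set X := _ * (_ + _).
have [q0 q1] := andP (decay_ratio e_gt0 e_lt1).
have e0 : 0 <= e := ltW e_gt0.
have gap0 k : (H <= k)%N -> gain_gap k = 0 by rewrite /gain_gap ltnNge => ->.
have X0 : 0 <= X.
  have i0 : 0 <= (1 - q)^-1 by rewrite invr_ge0 subr_ge0 ltW.
  have i1 : 0 <= (Num.sqrt (1 - q))^-1 by rewrite invr_ge0 sqrtr_ge0.
  rewrite /X; repeat first [exact: e0|exact: tau_ge0|exact: i0|exact: i1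
    |exact: spectral_norm_ge0|apply: exprn_ge0|apply: mulr_ge0|apply: addr_ge0].
have D0 : 0 <= D := sqrtr_ge0 _.
(* The constant of the boundary term. Only the decay of the closed-loop state is kept; the gap
   response is merely bounded. *)
pose C := spectral_norm P * (tau * (tau * spectral_norm B * (D / Num.sqrt (1 - q)))).
suff main : lambda * D ^+ 2 <= X * D.
  have [D00|D_neq0] := eqVneq D 0; first by rewrite D00 mulr0.
  have D_gt0 : 0 < D by rewrite lt_def D_neq0.
  by rewrite -(ler_pM2r D_gt0) -mulrA -expr2.
have lower T : lambda * D ^+ 2 <=
    \sum_(k < H + T) form (y k) (gain_gap k) (y k) (gain_gap k).
  rewrite big_split_ord /= ler_wpDr//.
    by apply: sumr_ge0 => k _; exact: (cost_form_ge0 pdQ.1 pdR.1 pdQ).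
  rewrite sqr_sqrtr; last by apply: sumr_ge0 => k _; rewrite sqr_ge0.
  rewrite mulr_sumr; apply: ler_sum => k _; rewrite l2norm_sqr.
  exact: (cost_form_ge pdQ.1 pdR.1 pdQ).
have upper T : \sum_(k < H + T) form (response A B 0 tail k) (tail k) (y k) (gain_gap k)
    <= X * D.
  apply: le_trans (cross_cost_le Q B R S tau_ge0 e_gt0 e_lt1 decA T
     (c := spectral_norm K * tau) _ _ _ gap0) _.
  - by rewrite mulr_ge0 ?spectral_norm_ge0.
  - by move=> k kH; rewrite /tail kH.
  - move=> k; rewrite /tail ltnNge leq_addr /= -mulrA.
    apply: le_trans (l2norm_mulmx _ _) _; rewrite ler_wpM2l ?spectral_norm_ge0//.
    apply: le_trans (decay_mulmx decAK _ _) _.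
    by rewrite ler_piMr// mulr_ge0 ?exprn_ge0.
  - by rewrite /X le_eqVlt; apply/orP; left; apply/eqP; ring.
have boundary T : dot (P *m (AK ^+ (H + T) *m v)) (y (H + T)%N) <= C * e ^+ (H + T).
  rewrite dot_mull psP.1; apply: le_trans (ler_norm _) _; apply: le_trans (form_le _ _ _) _.
  rewrite /C -mulrA ler_wpM2l ?spectral_norm_ge0//.
  rewrite [leRHS]mulrAC; apply: ler_pM; rewrite ?l2norm_ge0//.
    apply: le_trans (decay_mulmx decAK _ _) _.
    by rewrite ler_piMr// mulr_ge0 ?exprn_ge0.
  apply: le_trans (response_bound_l2 B tau_ge0 e_gt0 e_lt1 decA T gap0) _.
  rewrite ler_wpM2r ?divr_ge0 ?sqrtr_ge0// ler_piMr ?mulr_ge0 ?spectral_norm_ge0//.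
  by rewrite exprn_ile1// ltW.
(* By the decomposition, $f(T)$ dominates $\lambda D^2$ for every finite $T\ge H$, and it tends to
   $XD$. Thus no limit of the separate sums is needed. *)
pose f T := (\sum_(k < T) form (response A B v (fun k => padded L k *m v) k)
    (padded L k *m v) (y k) (gain_gap k)) + C * e ^+ T + X * D.
have cf : f @ \oo --> X * D.
  rewrite -[X in _ --> X]add0r; apply: cvgD; last exact: cvg_cst.
  rewrite -[X in _ --> X]addr0 -[X in _ + X](mulr0 C); apply: cvgD => //.
  by apply: cvgM; [exact: cvg_cst|apply: cvg_expr; rewrite ger0_norm].
rewrite -(cvg_lim (@Rhausdorff _) cf); apply: limr_ge; first by apply/cvg_ex; exists (X * D).
exists H => // T /= HT; rewrite /f gap_decomposition -(subnKC HT).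
by have := lower (T - H)%N; have := upper (T - H)%N; have := boundary (T - H)%N; lra.
Qed.

Lemma gain_gap0_le (H_gt0 : (0 < H)%N) :
  l2norm ((K - L (Ordinal H_gt0)) *m v) <= D.
Proof.
have -> : (K - L (Ordinal H_gt0)) *m v = - gain_gap 0.
  by rewrite /gain_gap H_gt0 mul1mx opprB mulmxBl /padded insubT; congr (_ - L _ *m _).
rewrite -scaleN1r l2normZ normrN normr1 mul1r.
rewrite -(@ler_pXn2r _ 2) ?nnegrE ?l2norm_ge0 ?sqrtr_ge0//.
rewrite [leRHS]sqr_sqrtr; last by apply: sumr_ge0 => k _; rewrite sqr_ge0.
rewrite (bigD1 (Ordinal H_gt0))//= lerDl sumr_ge0// => k _; exact: sqr_ge0.
Qed.

End FirstGain.

(** * Gaussian noise and the expected cost *)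

Section GaussianMoments.
Context {F : realType}.
Local Notation mu := (@lebesgue_measure F).
Local Notation gauss := (normal_prob (0 : F) 1).

(** The Radon-Nikodym derivative of the Gaussian law agrees almost everywhere with [normal_pdf],
    since both have the same integral over every measurable set. *)
Lemma ge0_integral_normal_prob (f : F -> \bar F) :
  measurable_fun setT f -> (forall x, 0 <= f x)%E ->
  (\int[gauss]_x f x = \int[mu]_x (f x * (normal_pdf 0 1 x)%:E))%E.
Proof.
move=> mf f0.
have dom : gauss `<< mu := @normal_prob_dominates F 0 1.
rewrite -(Radon_Nikodym_SigmaFinite.change_of_variables dom f0)//.
have mpdf : measurable_fun setT (fun x => (normal_pdf 0 1 x : F)%:E).
  by apply/measurable_EFinP; exact: measurable_normal_pdf.
apply: ae_eq_integral => //.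
- apply: emeasurable_funM => //.
  exact: measurable_int (Radon_Nikodym_SigmaFinite.f_integrable _).
- exact: emeasurable_funM.
- apply: ae_eqe_mul2l.
  apply: integral_ae_eq => //.
  + exact: Radon_Nikodym_SigmaFinite.f_integrable.
  + by move=> E _ mE; rewrite -Radon_Nikodym_SigmaFinite.f_integral.
Qed.

(* [x^2 exp(- x^2 / 2) <= 4 exp(- x^2 / 4)], again a Gaussian up to a factor. *)
Lemma normal_second_moment_lty : (\int[gauss]_x (x ^+ 2)%:E < +oo)%E.
Proof.
rewrite ge0_integral_normal_prob; last 2 first.
- by apply/measurable_EFinP; exact: measurable_funX.
- by move=> x; rewrite lee_fin sqr_ge0.
pose c : F := 4 * normal_peak 1 / normal_peak (Num.sqrt 2).
have s2 : Num.sqrt 2 != 0 :> F by rewrite gt_eqF// sqrtr_gt0.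
have c0 : 0 <= c by rewrite /c !mulr_ge0 ?invr_ge0 ?normal_peak_ge0.
apply: (@le_lt_trans _ _ (\int[mu]_x (c%:E * (normal_pdf 0 (Num.sqrt 2) x)%:E))%E).
  apply: ge0_le_integral => //=.
  - by move=> x _; rewrite mule_ge0// lee_fin ?sqr_ge0 ?normal_pdf_ge0.
  - apply: emeasurable_funM; apply/measurable_EFinP; first exact: measurable_funX.
    exact: measurable_normal_pdf.
  - apply: emeasurable_funM; apply/measurable_EFinP => //.
    exact: measurable_normal_pdf.
  - move=> x _; rewrite -!EFinM lee_fin !normal_pdfE// ?oner_eq0//.
    rewrite /c [leRHS]mulrA (mulfVK (lt0r_neq0 (normal_peak_gt0 s2))).
    rewrite [leLHS]mulrCA [4 * _]mulrC -[leRHS]mulrA ler_wpM2l ?normal_peak_ge0//.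
    rewrite /normal_fun !subr0 expr1n sqr_sqrtr//.
    have -> : - x ^+ 2 / (1 *+ 2) = - x ^+ 2 / 4 + - x ^+ 2 / 4 :> F.
      by field.
    have -> : - x ^+ 2 / (2 *+ 2) = - x ^+ 2 / 4 :> F by field.
    rewrite expRD mulrA ler_wpM2r ?expR_ge0// mulNr expRN.
    rewrite ler_pdivrMr ?expR_gt0// -ler_pdivrMl// mulrC.
    by apply: le_trans (expR_ge1Dx _); lra.
by rewrite integralZl ?integral_normal_pdf ?mule1 ?ltry//; exact: integrable_normal_pdf.
Qed.

(** Otherwise $x^2=0$ almost surely and the law is concentrated on $\{0\}$, which is null by
    domination by Lebesgue measure. *)
Lemma normal_second_moment_gt0 : (0 < \int[gauss]_x (x ^+ 2)%:E)%E.
Proof.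
rewrite lt0e integral_ge0 ?andbT; last by move=> x _; rewrite lee_fin sqr_ge0.
apply/eqP => I0.
have : ae_eq gauss setT (fun x : F => (x ^+ 2)%:E) (cst 0%E).
  apply/ae_eq_integral_abs => //.
    by apply/measurable_EFinP; exact: measurable_funX.
  by rewrite -[RHS]I0; apply: eq_integral => x _; rewrite gee0_abs// lee_fin sqr_ge0.
move=> [N [mN N0 sub]].
have sub1 : ~` [set 0 : F] `<=` N.
  move=> x x0; apply: sub => /= /(_ I) [] /eqP.
  by rewrite sqrf_eq0 => /eqP.
have : (gauss (~` [set 0%R]) = 0)%E.
  apply/eqP; rewrite -measure_le0 -N0; apply: le_measure => //; rewrite inE//.
  exact: measurableC.
have g0 : (gauss [set 0%R] = 0)%E.
  have /null_content_dominatesP := @normal_prob_dominates F 0 1; apply => //.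
  exact: lebesgue_measure_set1.
have /= := @probability_setC _ _ _ gauss [set 0 : F] (measurable_set1 _).
rewrite /= in g0 *.
by rewrite g0 sube0 => -> /eqP; rewrite onee_eq0.
Qed.

(** Substitution $x\mapsto -x$ and evenness of the density. Stated for nonnegative integrands, it
    yields the zero mean without presupposing integrability. *)
Lemma normal_pos_neg_parts : (\int[gauss]_x (Num.max x 0)%:E =
  \int[gauss]_x (Num.max (- x) 0)%:E)%E.
Proof.
have cpdf := @continuous_normal_pdf F 0 1 (oner_neq0 _).
have cid0 : continuous (fun x : F => Num.max x 0).
  by move=> x; apply: (@continuous_max _ _ (fun x : F => x) (fun=> 0)) => //; exact: cvg_cst.
have cid1 : continuous (fun x : F => Num.max (- x) 0).
  by move=> x; apply: (@continuous_max _ _ (fun x : F => - x) (fun=> 0)) => //;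
    [exact: opp_continuous|exact: cvg_cst].
have mM (f : F -> F) : continuous f -> measurable_fun setT (fun x => (f x)%:E).
  by move=> cf; apply/measurable_EFinP; exact: continuous_measurable_fun.
rewrite !ge0_integral_normal_prob; try (by move=> x; rewrite lee_fin le_max lexx orbT).
2,3: exact: mM.
transitivity (\int[mu]_(x in `[0%R, +oo[) ((Num.max x 0 * normal_pdf 0 1 x)%:E))%E.
  rewrite [RHS]integral_mkcond; apply: eq_integral => x _.
  rewrite patchE; case: ifPn; rewrite ?EFinM// notin_setE /= in_itv/= andbT.
  by move/negP; rewrite -ltNge => x0; rewrite max_r ?ltW// mul0e.
transitivity (\int[mu]_(x in `]-oo, 0%R]) ((Num.max (- x) 0 * normal_pdf 0 1 x)%:E))%E; last first.
  rewrite [LHS]integral_mkcond; apply: eq_integral => x _.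
  rewrite patchE; case: ifPn; rewrite ?EFinM// notin_setE /= in_itv/=.
  by move/negP; rewrite -ltNge => x0; rewrite max_r ?oppr_le0 ?ltW// mul0e.
have := @ge0_integration_by_substitutionNy F
  (fun x => Num.max (- x) 0 * normal_pdf 0 1 x) 0.
rewrite oppr0 => ->; last 2 first.
- by apply: continuous_subspaceT => x; apply: cvgM; [exact: cid1|exact: cpdf].
- by move=> x _; rewrite mulr_ge0 ?normal_pdf_ge0// le_max lexx orbT.
apply: eq_integral => x _ /=.
by rewrite opprK !normal_pdfE ?oner_eq0//= /normal_fun !subr0 sqrrN.
Qed.

End GaussianMoments.

(** * Means of noise variables and of their products *)

Section Means.
Context d (T : measurableType d) {F : realType} (Pr : probability T F).
Implicit Types (f g : T -> F) (a b c : F) (X Y : {RV Pr >-> F}).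

(** Integrability and value travel together, so that linearity applies without side conditions. *)
Definition has_mean f c : Prop :=
  Pr.-integrable setT (EFin \o f) /\ (\int[Pr]_x (f x)%:E = c%:E)%E.

Lemma has_mean_cst c : has_mean (fun=> c) c.
Proof.
split; first exact: finite_measure_integrable_cst.
by rewrite integral_cst//= probability_setT mule1.
Qed.

Lemma has_meanD f g a b : has_mean f a -> has_mean g b ->
  has_mean (fun x => f x + g x) (a + b).
Proof.
move=> [fi fE] [gi gE]; split.
  rewrite (_ : _ \o _ = (EFin \o f) \+ (EFin \o g)); first exact: integrableD.
  by apply/funext.
by rewrite integralD_EFin//= fE gE.
Qed.

Lemma has_meanZ f c a : has_mean f a -> has_mean (fun x => c * f x) (c * a).
Proof.
move=> [fi fE]; split.
  rewrite (_ : _ \o _ = (fun x => c%:E * (EFin \o f) x)%E); last by apply/funext.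
  exact: integrableZl.
under eq_integral do rewrite EFinM.
by rewrite integralZl// fE.
Qed.

Lemma has_mean_sum (I : Type) (r : seq I) (f : I -> T -> F) (c : I -> F) :
  (forall i, has_mean (f i) (c i)) ->
  has_mean (fun x => \sum_(i <- r) f i x) (\sum_(i <- r) c i).
Proof.
move=> fc; elim: r => [|i r IH].
  rewrite big_nil (_ : (fun x => _) = fun=> 0); first exact: has_mean_cst.
  by apply/funext => x; rewrite big_nil.
rewrite big_cons (_ : (fun x => _) = fun x => f i x + \sum_(i <- r) f i x).
  exact: has_meanD.
by apply/funext => x; rewrite big_cons.
Qed.

Lemma eq_has_mean f g a b : f =1 g -> a = b -> has_mean f a -> has_mean g b.
Proof. by move=> /funext -> ->. Qed.

(* This is 1, but only its positivity matters here. *)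
Definition gauss_var : F := fine (\int[normal_prob (0 : F) 1]_x (x ^+ 2)%:E)%E.

Lemma gauss_var_gt0 : 0 < gauss_var.
Proof.
apply: fine_gt0; rewrite normal_second_moment_lty andbT.
exact: normal_second_moment_gt0.
Qed.

Definition std_normal X : Prop := forall U : set F, measurable U ->
  distribution Pr X U = normal_prob 0 1 U.

(* [distribution Pr X] and [normal_prob] live on two copies of the Borel
   sigma-algebra of [F] with different displays, hence the retyping of [X]. *)
Lemma ge0_std_normal_integral X (f : F -> \bar F) : std_normal X ->
  measurable_fun setT f -> (forall x, 0 <= f x)%E ->
  (\int[Pr]_x f (X x) = \int[normal_prob (0 : F) 1]_x f x)%E.
Proof.
move=> sX mf f0.
have mX : @measurable_fun _ _ T (measurableTypeR F) setT X := measurable_funPT X.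
pose X' : {mfun T >-> measurableTypeR F} :=
  HB.pack (X : T -> measurableTypeR F) (isMeasurableFun.Build _ _ _ _ _ mX).
transitivity (\int[distribution Pr X']_x f x)%E.
  by rewrite ge0_integral_distribution.
by apply: eq_measure_integral => A mA _; exact: sX.
Qed.

Lemma std_normal_sqr_mean X : std_normal X -> has_mean (fun x => X x ^+ 2) gauss_var.
Proof.
move=> sX; have I : (\int[Pr]_x (X x ^+ 2)%:E = gauss_var%:E)%E.
  rewrite (ge0_std_normal_integral (f := fun x => (x ^+ 2)%:E) sX).
  - rewrite /gauss_var fineK// ge0_fin_numE ?normal_second_moment_lty//.
    by rewrite ltW ?normal_second_moment_gt0.
  - by apply/measurable_EFinP; exact: measurable_funX.
  - by move=> x; rewrite lee_fin sqr_ge0.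
split=> //; apply/integrableP; split.
  by apply/measurable_EFinP; exact: measurable_funX.
under eq_integral => x _ do rewrite /= ger0_norm ?sqr_ge0//.
by rewrite I ltry.
Qed.

Lemma integrable_prod_of_sqr X Y a b :
  has_mean (fun x => X x ^+ 2) a -> has_mean (fun x => Y x ^+ 2) b ->
  Pr.-integrable setT (EFin \o (fun x => X x * Y x)).
Proof.
move=> mX mY; have [iXY _] := has_meanD mX mY.
apply: le_integrable iXY => //.
  by apply/measurable_EFinP; exact: measurable_funM.
move=> x _; rewrite /= lee_fin.
rewrite [leRHS]ger0_norm ?addr_ge0 ?sqr_ge0// normrM -(real_normK (num_real (X x))).
rewrite -(real_normK (num_real (Y x))).
by have := sqr_ge0 (`|X x| - `|Y x|); have := normr_ge0 (X x); have := normr_ge0 (Y x); nra.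
Qed.

Lemma std_normal_mean X : std_normal X -> has_mean X 0.
Proof.
move=> sX; have iX : Pr.-integrable setT (EFin \o X).
  have [iX _] := has_meanD (has_mean_cst 1) (std_normal_sqr_mean sX).
  apply: le_integrable iX => //; first exact/measurable_EFinP.
  move=> x _; rewrite /= lee_fin [leRHS]ger0_norm ?addr_ge0 ?sqr_ge0//.
  rewrite -(real_normK (num_real (X x))).
  by have := sqr_ge0 (`|X x| - 1); have := normr_ge0 (X x); nra.
split=> //; have -> : (\int[Pr]_x (X x)%:E =
    \int[Pr]_x (Num.max (X x) 0)%:E - \int[Pr]_x (Num.max (- X x) 0)%:E)%E.
  rewrite integralE; congr (_ - _)%E; apply: eq_integral => x _.
    by rewrite /= funeposE /= EFin_max.
  by rewrite /= funenegE /= EFin_max EFinN.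
have m (f : F -> F) : continuous f -> measurable_fun setT (fun x => (f x)%:E).
  by move=> cf; apply/measurable_EFinP; exact: continuous_measurable_fun.
have cp : continuous (fun x : F => Num.max x 0).
  by move=> x; apply: (@continuous_max _ _ (fun x : F => x) (fun=> 0)) => //; exact: cvg_cst.
have cn : continuous (fun x : F => Num.max (- x) 0).
  by move=> x; apply: (@continuous_max _ _ (fun x : F => - x) (fun=> 0)) => //;
    [exact: opp_continuous|exact: cvg_cst].
rewrite (ge0_std_normal_integral (f := fun x => (Num.max x 0)%:E) sX (m _ cp));
  last by move=> x; rewrite lee_fin le_max lexx orbT.
rewrite (ge0_std_normal_integral (f := fun x => (Num.max (- x) 0)%:E) sX (m _ cn));
  last by move=> x; rewrite lee_fin le_max lexx orbT.
rewrite normal_pos_neg_parts subee//.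
rewrite -(ge0_std_normal_integral (f := fun x => (Num.max (- x) 0)%:E) sX (m _ cn));
  last by move=> x; rewrite lee_fin le_max lexx orbT.
have := integrable_neg_fin_num measurableT iX.
congr (_ \is a fin_num); apply: eq_integral => x _.
by rewrite /= funenegE /= EFin_max EFinN.
Qed.

(** The joint law agrees with the product law on rectangles, hence everywhere; in the iterated
    integral the inner one is a multiple of the zero mean of [Y]. *)
Lemma indep_prod_mean X Y : std_normal X -> std_normal Y ->
  (forall U V : set F, measurable U -> measurable V ->
    Pr (X @^-1` U `&` Y @^-1` V) = (Pr (X @^-1` U) * Pr (Y @^-1` V))%E) ->
  has_mean (fun x => X x * Y x) 0.
Proof.
move=> sX sY iXY.
have iprod := integrable_prod_of_sqr (std_normal_sqr_mean sX) (std_normal_sqr_mean sY).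
split=> //.
pose Z x := (X x, Y x).
have mZ : measurable_fun setT Z by exact: measurable_fun_pair.
pose m1 := distribution Pr X; pose m2 := distribution Pr Y.
pose h (z : measurableTypeR F * measurableTypeR F) := (z.1 * z.2)%:E.
have mh : measurable_fun setT h.
  by apply/measurable_EFinP; apply: measurable_funM.
have joint A : measurable A -> (m1 \x m2)%E A = pushforward Pr Z A.
  apply: (product_measure_unique (m' := pushforward Pr Z)) => U V mU mV.
  by rewrite /pushforward /m1 /m2 /distribution /= /pushforward -iXY.
have push : (\int[pushforward Pr Z]_z h z = \int[Pr]_x (X x * Y x)%:E)%E.
  by rewrite integral_pushforward.
have ih : (m1 \x m2)%E.-integrable setT h.
  have := integrable_pushforward mZ mh iprod measurableT.
  move=> /integrableP[_ fin]; apply/integrableP; split => //.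
  rewrite (@eq_measure_integral _ _ _ setT (pushforward Pr Z))//.
  by move=> A mA _; exact: joint.
transitivity (\int[m1 \x m2]_z h z)%E.
  rewrite -push; apply: eq_measure_integral => A mA _; exact/esym/joint.
rewrite -integral12_prod_meas1//.
have mean2 : (\int[m2]_y y%:E = 0)%E.
  have [iY EY] := std_normal_mean sY.
  by rewrite integral_distribution//; exact/measurable_EFinP.
have int2 : m2.-integrable setT (@EFin F).
  by apply: integrable_pushforward => //; have [] := std_normal_mean sY.
rewrite /fubini_F /h; under eq_integral => x _.
  under eq_integral do rewrite /= EFinM.
  rewrite integralZl// mean2 mule0.
  over.
by rewrite integral0.
Qed.

End Means.

(** * From the stochastic cost to the deterministic form *)

Section ExpectedCost.
Context d (T : measurableType d) {F : realType} (Pr : probability T F).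
Context {nx nu : nat} (w : nat -> 'I_nx -> {RV Pr >-> F}).
Hypothesis w_noise : std_gaussian_noise w.

Lemma noise_std_normal t i : std_normal (w t i).
Proof. by case: w_noise => /(_ t) [+ _] _; apply. Qed.

Lemma independent_pair (I : choiceType) (G : I -> set (set T)) (i j : I) (U V : set T) :
  mutually_independent Pr G -> i != j -> G i U -> G j V ->
  Pr (U `&` V) = (Pr U * Pr V)%E.
Proof.
move=> iG ij GU GV; have ji : (j == i) = false by rewrite eq_sym (negbTE ij).
have := iG [fset i; j]%fset (fun k => if k == i then U else V).
rewrite (_ : \bigcap_(k in _) _ = U `&` V); last first.
  apply/seteqP; split => [x cap|x [Ux Vx] k /=]; last by case: ifP.
  split; first by have := cap i; rewrite /= !inE eqxx; exact.
  by have := cap j; rewrite /= !inE eqxx orbT ji; exact.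
move=> ->; last first.
  by move=> k; rewrite !inE => /orP[] /eqP ->; rewrite ?eqxx ?ji.
by rewrite big_fsetU1 ?inE//= big_seq_fset1 eqxx ji.
Qed.

Lemma noise_uncorrelated s i r j : (s, i) != (r, j) ->
  has_mean Pr (fun om => w s i om * w r j om) 0.
Proof.
move=> ne; apply: indep_prod_mean; try exact: noise_std_normal.
(* At equal times the coordinates of one vector are independent; at different times the generated
   sigma-algebras are. *)
move=> U V mU mV; have [sr|sr] := eqVneq s r.
  subst r; have ij : i != j by apply: contraNneq ne => ->.
  case: w_noise => /(_ s) [_ ind] _.
  by apply: (independent_pair ind ij); [exists U|exists V] => //; rewrite setTI.
have gen t k W : measurable W -> g_sigma_preimage (w t) (w t k @^-1` W).
  move=> mW; apply: sub_sigma_algebra.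
  by rewrite (bigD1 k)//=; left; exists W => //; rewrite setTI.
case: w_noise => _ ind.
by apply: (independent_pair ind sr); exact: gen.
Qed.

Lemma mean_noise_lin (a : 'rV[F]_nx) s :
  has_mean Pr (fun om => (a *m noise_vec w s om) 0 0) 0.
Proof.
apply: (eq_has_mean (f := fun om => \sum_i a 0 i * w s i om) (a := \sum_(i < nx) a 0 i * 0)).
- by move=> om; rewrite mxE; apply: eq_bigr => i _; rewrite mxE.
- by rewrite big1// => i _; rewrite mulr0.
- apply: has_mean_sum => i; apply: has_meanZ.
  by apply: std_normal_mean; exact: noise_std_normal.
Qed.

Lemma mean_noise_quad (N : 'M[F]_nx) s r :
  has_mean Pr (fun om => ((noise_vec w s om)^T *m N *m noise_vec w r om) 0 0)
    (if s == r then gauss_var * \tr N else 0).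
Proof.
apply: (eq_has_mean (f := fun om => \sum_j \sum_i N i j * (w s i om * w r j om))
  (a := \sum_j \sum_i N i j * (if (s == r) && (i == j) then gauss_var else 0))).
- move=> om; rewrite mxE; apply: eq_bigr => j _; rewrite !mxE mulr_suml.
  by apply: eq_bigr => i _; rewrite !mxE mulrA [N i j * _]mulrC.
- case: eqP => _ /=; last by rewrite big1// => j _; rewrite big1// => i _; rewrite mulr0.
  rewrite /mxtrace mulr_sumr; apply: eq_bigr => j _.
  by rewrite (bigD1 j)//= eqxx big1 ?addr0 1?mulrC// => i /negbTE ->; rewrite mulr0.
- apply: has_mean_sum => j; apply: has_mean_sum => i; apply: has_meanZ.
  case: ifPn => [/andP[/eqP -> /eqP ->]|ne]; last exact: noise_uncorrelated.
  exact/std_normal_sqr_mean/noise_std_normal.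
Qed.

(** Terms linear in the noise have mean zero and products at different times are uncorrelated, so
    only the constant and the diagonal survive. The two affine functions are kept distinct to cover
    the $Q$, $R$ and $S$ terms at once. *)
Lemma mean_affine_form p q (M : 'M[F]_(p, q)) (x : 'cV[F]_p) (y : 'cV[F]_q) t
    (G : nat -> 'M[F]_(p, nx)) (K : nat -> 'M[F]_(q, nx)) :
  has_mean Pr (fun om => ((x + \sum_(s < t) G s *m noise_vec w s om)^T *m M *m
                          (y + \sum_(s < t) K s *m noise_vec w s om)) 0 0)
    ((x^T *m M *m y) 0 0 + gauss_var * \sum_(s < t) \tr ((G s)^T *m M *m K s)).
Proof.
pose W s om := noise_vec w s om.
apply: (eq_has_mean (f := fun om =>
    (x^T *m M *m y) 0 0 + (\sum_(s < t) (x^T *m M *m K s *m W s om) 0 0 +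
    (\sum_(s < t) (y^T *m M^T *m G s *m W s om) 0 0 +
     \sum_(s < t) \sum_(r < t) ((W s om)^T *m ((G s)^T *m M *m K r) *m W r om) 0 0)))
  (a := (x^T *m M *m y) 0 0 + (\sum_(s < t) 0 + (\sum_(s < t) 0 +
     \sum_(s < t) \sum_(r < t)
        (if (s : nat) == r then gauss_var * \tr ((G s)^T *m M *m K r) else 0))))).
- move=> om; set a := \sum_(s < t) G s *m _; set b := \sum_(s < t) K s *m _.
  have -> : (x + a)^T *m M *m (y + b) =
      x^T *m M *m y + (x^T *m M *m b + ((y^T *m M^T *m a)^T + a^T *m M *m b)).
    by rewrite [(x + a)^T]linearD /= !mulmxDl !mulmxDr !trmx_mul !trmxK mulmxA !addrA.
  have addE (N N' : 'M[F]_1) : (N + N') 0 0 = N 0 0 + N' 0 0 by rewrite mxE.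
  rewrite !addE [_^T 0 0]mxE; congr (_ + (_ + (_ + _))).
  + by rewrite mulmx_sumr summxE; apply: eq_bigr => s _; rewrite !mulmxA.
  + by rewrite mulmx_sumr summxE; apply: eq_bigr => s _; rewrite !mulmxA.
  + rewrite [a^T]linear_sum /= !mulmx_suml summxE; apply: eq_bigr => s _.
    rewrite mulmx_sumr summxE.
    by apply: eq_bigr => r _; rewrite trmx_mul !mulmxA.
- rewrite !big1_eq !add0r; congr (_ + _); rewrite mulr_sumr; apply: eq_bigr => s _.
  rewrite (bigD1 s)//= eqxx big1 ?addr0// => r; rewrite eq_sym.
  by rewrite -val_eqE /= => /negbTE ->.
- apply: has_meanD; first exact: has_mean_cst.
  apply: has_meanD; first by apply: has_mean_sum => s; exact: mean_noise_lin.
  apply: has_meanD; first by apply: has_mean_sum => s; exact: mean_noise_lin.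
  by apply: has_mean_sum => s; apply: has_mean_sum => r; exact: mean_noise_quad.
Qed.

Variables (A Q : 'M[F]_nx) (B : 'M[F]_(nx, nu)) (R : 'M[F]_nu) (S : 'M[F]_(nu, nx)).
Variables (x0 : 'cV[F]_nx) (H : nat) (L : 'I_H -> 'M[F]_(nu, nx)).

Lemma drc_inputE (v : nat -> 'cV[F]_nx) t :
  drc_input L v t = \sum_(s < t) padded L (t.-1 - s) *m v s.
Proof.
(* The range $H+t$ contains both the lags $k<H$ and the lags $k<t$ that reach actual noise; the
   terms outside either range are zero. Reversal $s=t-1-k$ then indexes by noise time. *)
transitivity (\sum_(k < H + t) if (k < t)%N then padded L k *m v (t.-1 - k)%N else 0).
  rewrite big_split_ord /= [X in _ + X]big1 ?addr0; last first.
    move=> k _; rewrite /padded insubF ?mul0mx ?if_same//.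
    by rewrite ltnNge leq_addr.
  apply: eq_bigr => k _; rewrite /past_noise /padded insubT//= => kH.
  rewrite (_ : Sub _ _ = k); last exact: val_inj.
  by case: ltnP => kt; rewrite ?mulmx0// subnS -predn_sub.
rewrite addnC big_split_ord /= [X in _ + X]big1 ?addr0; last first.
  by move=> k _; rewrite ltnNge leq_addr.
rewrite (reindex_inj rev_ord_inj) /=; apply: eq_bigr => s _.
have -> : (t - s.+1 < t)%N by case: t s => [[]//|t] s; rewrite subSS ltnS leq_subr.
by congr (padded L _ *m v _); have := ltn_ord s; lia.
Qed.

Local Notation Phi := (response A B 1%:M (padded L)).

Lemma drc_stateE (v : nat -> 'cV[F]_nx) t :
  lqr_state A B x0 v (drc_input L v) t =
  A ^+ t *m x0 + \sum_(s < t) Phi (t.-1 - s) *m v s.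
Proof.
elim: t => [|t IH] /=; first by rewrite expr0 mul1mx big_ord0 addr0.
have -> : A ^+ t.+1 = A *m A ^+ t := exprS A t.
rewrite IH drc_inputE mulmxDr !mulmxA -!addrA; congr (_ + _).
rewrite big_ord_recr /= subnn /= mul1mx addrA; congr (_ + _).
rewrite !mulmx_sumr -big_split /=; apply: eq_bigr => s _.
have -> : (t - s = (t.-1 - s).+1)%N by have := ltn_ord s; lia.
by rewrite /= mulmxDl !mulmxA.
Qed.

Local Notation mean_stage := (fun t => stage_cost Q R S (A ^+ t *m x0) 0 +
  gauss_var * \sum_(k < t) cost_form Q R S (Phi k) (padded L k) (Phi k) (padded L k)).

Lemma mean_stage_cost t :
  has_mean Pr (fun om => stage_cost Q R S
    (lqr_state A B x0 (noise_vec w ^~ om) (drc_input L (noise_vec w ^~ om)) t)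
    (drc_input L (noise_vec w ^~ om) t)) (mean_stage t).
Proof.
pose x := A ^+ t *m x0; pose G s := Phi (t.-1 - s); pose K s := padded L (t.-1 - s).
pose sx om := x + \sum_(s < t) G s *m noise_vec w s om.
pose su om := (0 : 'cV[F]_nu) + \sum_(s < t) K s *m noise_vec w s om.
apply: (eq_has_mean (f := fun om => ((sx om)^T *m Q *m sx om) 0 0 +
   (((su om)^T *m R *m su om) 0 0 + 2 * ((su om)^T *m S *m sx om) 0 0))
  (a := ((x^T *m Q *m x) 0 0 + gauss_var * \sum_(s < t) \tr ((G s)^T *m Q *m G s)) +
   ((((0 : 'cV[F]_nu)^T *m R *m 0) 0 0 + gauss_var * \sum_(s < t) \tr ((K s)^T *m R *m K s)) +
   2 * (((0 : 'cV[F]_nu)^T *m S *m x) 0 0 + gauss_var * \sum_(s < t) \tr ((K s)^T *m S *m G s))))).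
- by move=> om; rewrite drc_stateE drc_inputE /stage_cost /sx /su add0r !mxE addrA.
- rewrite /stage_cost !trmx0 !mul0mx !mxE add0r mulr0 !addr0 -addrA; congr (_ + _).
  rewrite add0r [2 * _]mulrCA -!mulrDr; congr (_ * _); rewrite mulr_sumr -!big_split /=.
  rewrite (reindex_inj rev_ord_inj) /=; apply: eq_bigr => s _; rewrite /G /K.
  have -> : (t.-1 - (t - s.+1) = s)%N by have := ltn_ord s; lia.
  rewrite /cost_form !linearD /= -!addrA; congr (_ + (_ + _)).
  by rewrite mulr_natl mulr2n.
- apply: has_meanD; first exact: mean_affine_form.
  apply: has_meanD; first exact: mean_affine_form.
  by apply: has_meanZ; exact: mean_affine_form.
Qed.

(** Cesàro: the time average of the expected stage costs has the same limit as the stage costs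
    themselves. *)
Lemma drc_cost_lim (l : F) :
  mean_stage @ \oo --> l -> drc_cost A B Q R S x0 w L = l%:E.
Proof.
move=> /cesaro cl; rewrite /drc_cost /lqr_cost.
apply: cvg_lim => //; rewrite -cvg_shiftS.
rewrite (_ : [sequence _]_n = EFin \o arithmetic_mean mean_stage).
  by apply: cvg_EFin; [exact: nearW|exact: cl].
apply/funext => n /=; rewrite unlock.
have [_ ->] := has_mean_sum (index_enum 'I_n.+1) (fun t => mean_stage_cost t).
by rewrite -EFinM /arithmetic_mean /series /= big_mkord.
Qed.

End ExpectedCost.

(** * Stationarity of the minimizer *)

Section Stationarity.
Context d (T : measurableType d) {F : realType} (Pr : probability T F).
Context {nx nu : nat} (w : nat -> 'I_nx -> {RV Pr >-> F}).
Hypothesis w_noise : std_gaussian_noise w.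
Variables (A Q : 'M[F]_nx) (B : 'M[F]_(nx, nu)) (R : 'M[F]_nu) (S : 'M[F]_(nu, nx)).
Variables (tau e : F) (x0 : 'cV[F]_nx) (H : nat).
Hypotheses (tau_ge0 : 0 <= tau) (e_gt0 : 0 < e) (e_lt1 : e < 1).
Hypothesis decA : forall k, spectral_norm (A ^+ k) <= tau * e ^+ k.
Hypotheses (pdQ : posdef Q) (pdR : posdef R) (pdW : posdef (block_mx Q S^T S R)).
Local Notation form := (cost_form Q R S).
Local Notation cost L := (drc_cost A B Q R S x0 w L).
Implicit Types (L D : 'I_H -> 'M[F]_(nu, nx)).

Lemma padded_ge L k : (H <= k)%N -> padded L k = 0.
Proof. by move=> Hk; rewrite /padded insubF// ltnNge Hk. Qed.

Lemma padded_lin L D a k :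
  padded (fun i => L i + a *: D i) k = padded L k + a *: padded D k.
Proof. by rewrite /padded; case: insubP => //; rewrite scaler0 addr0. Qed.

Lemma drc_cost_cvg L l :
  (fun t => \sum_(k < t) form (response A B 1%:M (padded L) k) (padded L k)
     (response A B 1%:M (padded L) k) (padded L k)) @ \oo --> l ->
  cost L = (gauss_var * l)%:E.
Proof.
move=> cl; apply: drc_cost_lim => //; rewrite -[X in _ --> X]add0r.
apply: cvgD; first exact: (cvg_free_cost R S tau_ge0 e_gt0 e_lt1 decA).
by apply: cvgM; [exact: cvg_cst|exact: cl].
Qed.

Lemma quadratic_ge0_linear_eq0 (a c : F) : 0 <= c ->
  (forall s, 0 <= 2 * s * a + s ^+ 2 * c) -> a = 0.
Proof.
(* The shift to $c+1$ covers $c=0$ as well; the value there is $-(a/(c+1))^2(c+2)$. *)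
move=> c0 h; have := h (- a / (c + 1)); have c1 : c + 1 != 0 by rewrite gt_eqF ?ltr_wpDl.
have -> : 2 * (- a / (c + 1)) * a + (- a / (c + 1)) ^+ 2 * c =
    - (a / (c + 1)) ^+ 2 * (c + 2) by field.
rewrite mulNr oppr_ge0 pmulr_lle0; last by rewrite ltr_wpDl.
move=> sq0; have : (a / (c + 1)) ^+ 2 == 0 by rewrite eq_le sq0 sqr_ge0.
by rewrite sqrf_eq0 mulf_eq0 invr_eq0 (negbTE c1) orbF => /eqP.
Qed.

(* First-order optimality against the rank one perturbation [L_k + s u_k v^T]. *)
Lemma drc_stationary L (v : 'cV[F]_nx) (u : nat -> 'cV[F]_nu) :
  (forall L', (cost L <= cost L')%E) -> (forall k, (H <= k)%N -> u k = 0) ->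
  (fun t => \sum_(k < t) form (response A B v (fun k => padded L k *m v) k)
     (padded L k *m v) (response A B 0 u k) (u k)) @ \oo --> 0.
Proof.
move=> optL u0; pose D (i : 'I_H) := u i *m v^T.
have symQ := pdQ.1; have symR := pdR.1.
have padD k : padded D k = u k *m v^T.
  rewrite /padded /D; case: insubP => [i _ <-//|]; rewrite -leqNgt => Hk.
  by rewrite u0// mul0mx.
pose q (X : 'M[F]_nx) (U : nat -> 'M[F]_(nu, nx)) t := \sum_(k < t)
  form (response A B X U k) (U k) (response A B X U k) (U k).
have qcvg X U : (forall k, (H <= k)%N -> U k = 0) -> cvgn (q X U).
  exact: (cost_sum_cvg tau_ge0 e_gt0 e_lt1 decA).
pose a t := \sum_(k < t) form (response A B 1%:M (padded L) k) (padded L k)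
  (response A B 0 (padded D) k) (padded D k).
have aE t : \sum_(k < t) form (response A B v (fun k => padded L k *m v) k)
     (padded L k *m v) (response A B 0 u k) (u k) = a t.
  apply: eq_bigr => k _.
  have -> : response A B 0 (padded D) k = response A B 0 u k *m v^T.
    by rewrite (eq_response _ _ _ _ padD) -response_mulr mul0mx.
  by rewrite padD cost_form_rank1 -response_mulr mul1mx.
under eq_fun do rewrite aE.
have qE s t : q 1%:M (padded (fun i => L i + s *: D i)) t =
    q 1%:M (padded L) t + 2 * s * a t + s ^+ 2 * q 0 (padded D) t.
  rewrite /q /a !mulr_sumr -!big_split /=; apply: eq_bigr => k _.
  rewrite (eq_response _ _ _ _ (padded_lin L D s)) padded_lin -cost_form_quad//.
  have := response_lin A B 1%:M 0 (padded L) (padded D) s k.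
  by rewrite scaler0 addr0 => ->.
have cL := qcvg 1%:M (padded L) (@padded_ge L).
have cD := qcvg 0 (padded D) (@padded_ge D).
have c1 := qcvg 1%:M _ (@padded_ge (fun i => L i + 1 *: D i)).
pose lL := limn (q 1%:M (padded L)); pose lD := limn (q 0 (padded D)).
(* The cross sums are not monotone, so their limit is obtained by polarization from three convergent
   quadratic sums. *)
pose la := (limn (q 1%:M (padded (fun i => L i + 1 *: D i))) - lL - lD) / 2.
have ca : a @ \oo --> la.
  have -> : a = (fun t => (q 1%:M (padded (fun i => L i + 1 *: D i)) t -
      q 1%:M (padded L) t - q 0 (padded D) t) / 2).
    by apply/funext => t; rewrite qE; field.
  apply: cvgM; last exact: cvg_cst.
  by apply: cvgB; [apply: cvgB; [exact: c1|exact: cL]|exact: cD].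
have cE s : cost (fun i => L i + s *: D i) = (gauss_var * (lL + 2 * s * la + s ^+ 2 * lD))%:E.
  apply: drc_cost_cvg; under eq_fun do rewrite -/(q _ _ _) qE.
  apply: cvgD; last by apply: cvgM; [exact: cvg_cst|exact: cD].
  by apply: cvgD; [exact: cL|apply: cvgM; [exact: cvg_cst|exact: ca]].
have la0 : la = 0.
  apply: (@quadratic_ge0_linear_eq0 _ lD).
    apply: limr_ge; first exact: cD.
    apply: nearW => t; apply: sumr_ge0 => k _.
    exact: (cost_form_ge0 symQ symR pdQ).
  move=> s; have := optL (fun i => L i + s *: D i).
  rewrite cE (drc_cost_cvg cL) lee_fin ler_pM2l ?gauss_var_gt0// -addrA lerDl.
  by [].
by rewrite -la0.
Qed.

End Stationarity.

(** * Assembly of the bound *)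

Theorem theorem2 (F : realType) (nx nu : nat)
  (A : 'M[F]_nx) (B : 'M[F]_(nx, nu))
  (Q : 'M[F]_nx) (R : 'M[F]_nu) (S : 'M[F]_(nu, nx))
  (P : 'M[F]_nx) (Kstar : 'M[F]_(nu, nx))
  (tau rho : F)
  (d : measure_display) (T : measurableType d) (Pr : probability T F)
  (w : nat -> 'I_nx -> {RV Pr >-> F}) (x0 : 'cV[F]_nx)
  (H : nat) (H_gt0 : (0 < H)%N) (Lstar : 'I_H -> 'M[F]_(nu, nx)) :
  spectral_radius A < 1 ->
  posdef Q -> posdef R -> posdef (block_mx Q S^T S R) ->
  possemidef P -> dare_solution A B Q R S P ->
  Kstar = lqr_gain A B R S P ->
  1 <= tau -> 0 < rho ->
  (forall k : nat, spectral_norm (A ^+ k) <= tau * expR (- rho * k%:R)) ->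
  (forall k : nat,
     spectral_norm ((A + B *m Kstar) ^+ k) <= tau * expR (- rho * k%:R)) ->
  std_gaussian_noise w ->
  (forall L : 'I_H -> 'M[F]_(nu, nx),
     (drc_cost A B Q R S x0 w Lstar <= drc_cost A B Q R S x0 w L)%E) ->
  spectral_norm (Kstar - Lstar (Ordinal H_gt0)) <=
    2 * tau ^+ 3
      * (spectral_norm B ^+ 2 * spectral_norm Kstar * spectral_norm Q
         + spectral_norm B * spectral_norm Kstar * spectral_norm S)
    / (lambda_min (R - S *m invmx Q *m S^T)
       * (1 - expR (- 2 * rho)) `^ (5 / 2))
    * expR (- H%:R * rho).
Proof.
move=> _ pdQ pdR pdW psP dareP -> tau1 rho0 decA decAK w_noise optL.
have tau0 : 0 <= tau := le_trans ler01 tau1.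
pose e : F := expR (- rho).
have e_gt0 : 0 < e := expR_gt0 _.
have e_lt1 : e < 1 by rewrite expR_lt1 oppr_lt0.
have expE k : expR (- rho * k%:R) = e ^+ k by rewrite expRM_natr.
have {}decA k : spectral_norm (A ^+ k) <= tau * e ^+ k by rewrite -expE.
have {}decAK k : spectral_norm ((A + B *m lqr_gain A B R S P) ^+ k) <= tau * e ^+ k.
  by rewrite -expE.
have -> : expR (- H%:R * rho) = e ^+ H by rewrite -expE mulNr mulrC mulNr.
have -> : expR (- 2 * rho) = e ^+ 2 by rewrite -expE mulNr mulrC mulNr.
set K := lqr_gain A B R S P in decAK *.
have [q0 q1] := andP (decay_ratio e_gt0 e_lt1).
pose s := Num.sqrt (1 - e ^+ 2).
have s0 : 0 < s by rewrite sqrtr_gt0 subr_gt0.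
have s1 : s <= 1.
  by rewrite -[leRHS]sqrtr1 ler_sqrt// gerBl.
have s2E : s ^+ 2 = 1 - e ^+ 2 by rewrite sqr_sqrtr// subr_ge0 ltW.
have sE : (1 - e ^+ 2) `^ (5 / 2) = s ^+ 5.
  rewrite -s2E -powR_mulrn ?(ltW s0)// -powRrM (_ : 2%:R * (5 / 2) = 5%:R); last by field.
  by rewrite powR_mulrn ?(ltW s0).
rewrite sE.
have nn m n (M : 'M[F]_(m, n)) : 0 <= spectral_norm M := spectral_norm_ge0 M.
(* Without inputs the matrices have no rows and the left-hand side is 0; the right-hand side is 0
   too, as the denominator is 0 and its inverse is 0 by convention. *)
have [nu0|nu_gt0] := posnP nu.
  rewrite lambda_min_dim0// mul0r invr0 mulr0 mul0r.
  apply: spectral_norm_le => x _; rewrite (_ : _ *m x = 0) ?l2norm0//.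
  by apply/colP => i; have := ltn_ord i; rewrite {2}nu0.
have pdN := schur_posdef pdQ.1 pdR.1 pdQ pdW.
have [lam0 _] := lambda_minP nu_gt0 pdN.
set lam := lambda_min _ in lam0 *.
apply: spectral_norm_le => v v1.
apply: le_trans (gain_gap0_le A P B R S Lstar v H_gt0) _.
have gap0 k : (H <= k)%N -> gain_gap A P B R S Lstar v k = 0.
  by rewrite /gain_gap ltnNge => ->.
(* Stationarity is used in the direction of the gap itself. *)
have stat := drc_stationary w_noise tau0 e_gt0 e_lt1 decA pdQ pdR pdW v optL gap0.
have := gap_bound tau0 e_gt0 e_lt1 pdQ pdR pdW psP dareP decA decAK nu_gt0 v1 stat.
rewrite mulrC -ler_pdivlMr// => /le_trans; apply; rewrite -/s -s2E -/K.
move: (spectral_norm B) (spectral_norm K) (spectral_norm Q) (spectral_norm S)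
  (nn _ _ B) (nn _ _ K) (nn _ _ Q) (nn _ _ S) => b k nQ nS b0 k0 nQ0 nS0.
have s_neq0 := lt0r_neq0 s0; have lam_neq0 := lt0r_neq0 lam0.
have -> : 2 * tau ^+ 3 * (b ^+ 2 * k * nQ + b * k * nS) / (lam * s ^+ 5) * e ^+ H =
    2 * (e ^+ H / s ^+ 5 * (tau ^+ 3 * b ^+ 2 * k * nQ + tau ^+ 3 * b * k * nS)) / lam.
  by field; rewrite ?lam_neq0 ?s_neq0.
rewrite ler_pM2r ?invr_gt0//.
(* Since $s=\sqrt{1-q}$, the $Q$ term carries $s^{-1}s^{-4}=s^{-5}$, that is $(1-q)^{-5/2}$. The $S$
   term carries $s^{-3}\tau^2$ and is raised to $s^{-5}\tau^3$ by $s\le 1\le\tau$. *)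
have -> : e ^+ H / s * (k * tau) * ((tau * b) ^+ 2 * nQ * (s ^+ 2)^-1 ^+ 2 +
      tau * b * nS * (s ^+ 2)^-1) =
    e ^+ H / s ^+ 5 * (tau ^+ 3 * b ^+ 2 * k * nQ + tau ^+ 2 * b * k * nS * s ^+ 2).
  by field.
have c0 : 0 <= e ^+ H / s ^+ 5 by rewrite divr_ge0 ?exprn_ge0 ?ltW.
have Q0 : 0 <= tau ^+ 3 * b ^+ 2 * k * nQ by rewrite !mulr_ge0 ?exprn_ge0.
have S0 : 0 <= tau ^+ 2 * b * k * nS by rewrite !mulr_ge0 ?exprn_ge0.
have S1 : tau ^+ 2 * b * k * nS * s ^+ 2 <= tau ^+ 2 * b * k * nS.
  by rewrite ler_piMr// exprn_ile1// ltW.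
have S2 : tau ^+ 2 * b * k * nS <= tau ^+ 3 * b * k * nS.
  by rewrite exprS -!mulrA ler_peMl// !mulrA.
rewrite [leRHS]mulrCA ler_wpM2l//; lra.
Qed.
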